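(* There is an absolute constant $c>0$ such that $$H_\alpha\ \ge\ c\,\sqrt{\alpha}\,\Bigl(\frac{e\alpha}{2}\Bigr)^{1/\alpha}\qquad\text{for all }0<\alpha\le 2,$$ where $H_\alpha$ denotes the Pickands constant.
   Context: For $0<\alpha\le 2$ the Pickands constant $H_\alpha$ is the constant (depending only on $\alpha$) appearing in Pickands' theorem: if $\{Z(t)\}$ is a mean zero, variance one stationary Gaussian process (with continuous sample paths) whose covariance function satisfies $r(t)=1-C|t|^\alpha+o(|t|^\alpha)$ as $t\to 0$, where $C>0$, and if $h>0$ is fixed and $\sup_{\varepsilon\le t\le h}r(t)<1$ for all $\varepsilon>0$, then $$\lim_{u\to\infty}e^{u^2/2}\,u^{1-2/\alpha}\,\mathbb{P}\Bigl(\sup_{0\le t\le h}Z(t)>u\Bigr)=\frac{h\,C^{1/\alpha}H_\alpha}{\sqrt{2\pi}}.$$ *)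

(* Defs.v *)
From HB Require Import structures.
From mathcomp Require Import all_boot all_order all_algebra.
From mathcomp Require Import all_classical all_reals all_analysis.
Set Implicit Arguments.
Unset Strict Implicit.
Unset Printing Implicit Defensive.
Import Order.TTheory GRing.Theory Num.Theory.
Import numFieldNormedType.Exports.
Local Open Scope classical_set_scope.
Local Open Scope ring_scope.

(* Point masses are listed separately because [normal_prob m 0] is not the
   point mass at [m] in the library (it is the uniform law on [0, 1]). *)
Definition gaussian_law {R : realType} (mu : set R -> \bar R) : Prop :=
  (exists m s : R, s != 0 /\
     forall A : set R, measurable A -> mu A = normal_prob m s A) \/
  (exists m : R, forall A : set R, measurable A -> mu A = \d_m A).

Section Process.
Context {R : realType} {d : measure_display} {T : measurableType d}.
Variables (P : probability T R) (Z : R -> {RV P >-> R}).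

Definition gaussian_process : Prop :=
  forall (n : nat) (t a : 'I_n -> R),
    gaussian_law (pushforward P (fun w => \sum_(i < n) a i * Z (t i) w)).

(* Translation invariance is imposed on means and covariances only: together
   with [gaussian_process] this is stationarity of all the finite-dimensional
   laws. *)
Definition has_stationary_covariance (r : R -> R) : Prop :=
  forall s t : R, covariance P (Z s) (Z t) = (r (t - s))%:E.

Definition continuous_paths : Prop :=
  forall w : T, continuous (fun t : R => Z t w).

Definition std_stationary_gaussian (r : R -> R) : Prop :=
  [/\ gaussian_process,
      (forall t : R, ('E_P[Z t] = 0)%E),
      (forall t : R, ('V_P[Z t] = 1)%E),
      has_stationary_covariance r
    & continuous_paths].

Definition sup_exceeds (h u : R) : set T :=
  [set w | u < sup [set Z t w | t in `[0, h]]].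

End Process.

(* For [h < eps] the supremum is over the empty set, where [sup set0 = 0],
   so nothing is imposed. *)
Definition pickands_covariance {R : realType} (alpha C h : R) (r : R -> R) :
    Prop :=
  (fun t : R => r t - (1 - C * `|t| `^ alpha)) =o_ (0 : R)
    (fun t : R => `|t| `^ alpha) /\
  (forall eps : R, 0 < eps -> sup [set r t | t in `[eps, h]] < 1).

Definition pickands_theorem_for {R : realType} (alpha H : R) : Prop :=
  forall (d : measure_display) (T : measurableType d) (P : probability T R)
         (Z : R -> {RV P >-> R}) (r : R -> R) (C h : R),
    0 < C -> 0 < h ->
    std_stationary_gaussian Z r ->
    pickands_covariance alpha C h r ->
    (fun u : R => expR (u ^+ 2 / 2) * u `^ (1 - 2 / alpha)
                  * fine (P (sup_exceeds Z h u))) @ +oo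
      --> h * C `^ alpha^-1 * H / Num.sqrt (2 * pi).

(* [unique Q H] is [Q H /\ forall H', Q H' -> H = H']: [H] is the constant for
   which the asymptotics hold.  Without uniqueness, an [alpha] admitting no
   process as above would make every real number qualify. *)
Definition is_pickands_constant {R : realType} (alpha H : R) : Prop :=
  unique (pickands_theorem_for alpha) H.

(* Main.v *)
(** Uniqueness of the Pickands constant forces a process satisfying the
    hypotheses of Pickands' theorem to exist, so it suffices to bound from below
    the excursion probability of that process.  Restrict it to a mesh of step
    [a * u^(-2/alpha)] and use Bonferroni's inequality [P(U A_j) >= sum P(A_j) -
    sum P(A_i & A_j)].

    The plain events [A_j = {Z_j > u}] are enough when [alpha] is bounded away
    from 0, but for small [alpha] they lose a factor exponential in [1/alpha].
    There one takes [A_j = {Z_j > u, L_j <= u - M/u}], where [L_j] is the average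
    of [Z] over [m] points to the left of the site [j], at distances where [1 - r]
    is about [2.2 / (alpha u^2)]: asking this average to be lower than expected
    costs less than it gains in the pair probabilities.

    All the joint probabilities reduce to one-dimensional Gaussian tails: if the
    coefficients [c] sum to 1, then [G = sum c_i Z(t + y_i u^(-2/alpha))] has
    variance about [1 - Q/u^2] with [Q = sum c_i c_j C |y_i - y_j|^alpha], so that
    [P(G > u + tau/u)] is of order [exp(-u^2/2 - Q/2 - tau) / u].  [P(A_j)] is
    bounded below by the tail of [Y = (3/2) Z_j - (1/2) L_j] minus the tails of two
    combinations covering the cases where [Y] is large although [A_j] fails, and
    [P(A_i & A_j)] is bounded above by the tail of
    [(5/4) Z_i + (3/4) Z_j - L_i], or of [(Z_i + Z_j) / 2] for distant sites. *)
Require Import Defs.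
Set Implicit Arguments.
Unset Strict Implicit.
Unset Printing Implicit Defensive.
From HB Require Import structures.
From mathcomp Require Import all_boot all_order all_algebra.
From mathcomp Require Import all_classical all_reals all_analysis.
From mathcomp Require Import measurable_realfun normal_distribution.
From mathcomp Require Import ring lra.
Import Order.TTheory GRing.Theory Num.Theory.
Import numFieldNormedType.Exports.
Local Open Scope classical_set_scope.
Local Open Scope ring_scope.

(** * Second moments of the normal law *)

Section normal_moment.
Context {R : realType}.
Notation mu := (@lebesgue_measure R).
Variables (m s c : R).
Hypothesis s0 : s != 0.

Let g x : R := normal_pdf m s x.
Let K := s ^+ 2 + (m - c) ^+ 2.
(** An antiderivative of [k], because [(x + m - 2 c) (x - m) = (x - c)^2 - (m - c)^2]. *)
Let F x : R := - (s ^+ 2 * (x + m - 2 * c) * g x).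
Let k x : R := ((x - c) ^+ 2 - K) * g x.

Let gE x : g x = normal_peak s * expR (- (x - m) ^+ 2 / (s ^+ 2 *+ 2)).
Proof. by rewrite /g normal_pdfE. Qed.

Let derF (x : R) : is_derive x 1 F (k x).
Proof.
have -> : F = fun x => - (s ^+ 2 * (x + m - 2 * c) *
    (normal_peak s * expR (- (x - m) ^+ 2 / (s ^+ 2 *+ 2)))).
  by apply/funext => y; rewrite -gE.
apply: is_derive_eq.
rewrite /GRing.scale /= /k gE -mulr_natr /K.
by field.
Qed.

Let dF (x : R) : derivable F x 1.
Proof. by case: (derF x). Qed.

Let cF : continuous F.
Proof. by move=> x; apply: differentiable_continuous; apply/derivable1_diffP. Qed.

Let cg : continuous g.
Proof. exact: continuous_normal_pdf. Qed.

Let csq : continuous (fun x : R => (x - c) ^+ 2).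
Proof.
move=> x; apply: differentiable_continuous; exact/derivable1_diffP.
Qed.

Let ck : continuous k.
Proof.
move=> x; apply: cvgM; last exact: cg.
by apply: cvgB; [exact: csq|exact: cvg_cst].
Qed.

Let itv (n : nat) : set R := `[m - n%:R, m + n%:R].

Let bigcup_itv : \bigcup_n itv n = setT.
Proof.
rewrite -subTset => x _; exists (Num.truncn `|x - m|).+1 => //=.
have /ltW := truncnS_gt `|x - m|.
by rewrite /itv /= in_itv /= ler_distl => /andP[-> ->].
Qed.

Let cvg_itv (f : R -> R) : (forall x, 0 <= f x) -> continuous f ->
  (\int[mu]_(x in itv n) (f x)%:E)%E @[n --> \oo] --> (\int[mu]_x (f x)%:E)%E.
Proof.
move=> f0 cf; rewrite -bigcup_itv.
apply: ge0_nondecreasing_set_cvg_integral.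
- move=> n p np; apply/subsetPset => x; rewrite /itv /= !in_itv /= => /andP[h1 h2].
  have np' : n%:R <= p%:R :> R by rewrite ler_nat.
  by apply/andP; split; lra.
- by move=> n; exact: measurable_itv.
- move=> n; apply/measurable_EFinP; apply: measurable_funTS.
  exact: continuous_measurable_fun.
- by move=> n x _; rewrite lee_fin.
Qed.

(** Since [(x - c)^2 g = k + K g], integrating over [[m - n, m + n]] leaves boundary values of [F],
    which vanish as [n] grows, plus a term tending to [K]. *)
Lemma normal_pdf_second_moment :
  (\int[mu]_x ((x - c) ^+ 2 * normal_pdf m s x)%:E)%E = K%:E.
Proof.
pose h x : R := (x - c) ^+ 2 * g x.
have h0 x : 0 <= h x by rewrite mulr_ge0 ?sqr_ge0 ?normal_pdf_ge0.
have ch : continuous h by move=> x; apply: cvgM; [exact: csq|exact: cg].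
have Ih n : mu.-integrable (itv n) (EFin \o h).
  apply: continuous_compact_integrable; first exact: segment_compact.
  exact: continuous_subspaceT.
have Ig n : mu.-integrable (itv n) (EFin \o g).
  apply: continuous_compact_integrable; first exact: segment_compact.
  exact: continuous_subspaceT.
have mitv n : measurable (itv n : set (measurableTypeR R)) by exact: measurable_itv.
have hE n : (0 < n)%N -> (\int[mu]_(x in itv n) (h x)%:E =
    (F (m + n%:R) - F (m - n%:R))%:E + K%:E * \int[mu]_(x in itv n) (g x)%:E)%E.
  move=> n0.
  have n0' : (0 < n%:R :> R) by rewrite ltr0n.
  rewrite EFinB -(@continuous_FTC2 _ k).
  - rewrite -integralZl; [|exact: mitv|exact: Ig].
    rewrite -integralD; [|exact: mitv| |].
    + by apply: eq_integral => x _; rewrite -EFinM -EFinD /h /k; congr EFin; ring.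
    + apply: continuous_compact_integrable; first exact: segment_compact.
      exact: continuous_subspaceT.
    + apply: integrableZl => //; exact: Ig.
  - lra.
  - exact: continuous_subspaceT.
  - split.
    + by move=> x _; exact: dF.
    + by apply: cvg_at_right_filter; exact: cF.
    + by apply: cvg_at_left_filter; exact: cF.
  - move=> x _; by rewrite derive1E; case: (derF x).
have F0 : (F (m + n%:R) - F (m - n%:R)) @[n --> \oo] --> (0 : R).
  have pk := normal_peak_ge0 s.
  have s20 : 0 < s ^+ 2 by rewrite exprn_even_gt0.
  have -> : (fun n : nat => F (m + n%:R) - F (m - n%:R)) = fun n =>
      - (2 * s ^+ 2 * normal_peak s) *
      (n%:R * expR (- (n%:R ^+ 2 / (s ^+ 2 *+ 2)))).
    apply/funext => n; rewrite /F !gE.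
    have -> : - (m + n%:R - m) ^+ 2 / (s ^+ 2 *+ 2) =
        - (n%:R ^+ 2 / (s ^+ 2 *+ 2)) :> R by rewrite (addrC m) addrK mulNr.
    have -> : - (m - n%:R - m) ^+ 2 / (s ^+ 2 *+ 2) =
        - (n%:R ^+ 2 / (s ^+ 2 *+ 2)) :> R.
      by rewrite addrAC subrr sub0r sqrrN mulNr.
    ring.
  rewrite -[X in _ --> X](mulr0 (- (2 * s ^+ 2 * normal_peak s))).
  apply: cvgM; first exact: cvg_cst.
  (* The inequality [expR y >= 1 + y] gives the upper bound [2 s^2 / n]. *)
  apply: (@squeeze_cvgr _ _ _ _ (cst 0) (fun n => (s ^+ 2 *+ 2) * n%:R^-1)).
  - near=> n.
    have n0 : 0 < n%:R :> R by rewrite ltr0n; near: n; exact: nbhs_infty_gt.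
    apply/andP; split; first by rewrite mulr_ge0 ?expR_ge0.
    rewrite expRN ler_pdivrMr ?expR_gt0//.
    apply: (@le_trans _ _ (s ^+ 2 *+ 2 / n%:R * (n%:R ^+ 2 / (s ^+ 2 *+ 2)))).
      by rewrite le_eqVlt -mulr_natr; apply/orP; left; apply/eqP; field;
        rewrite s0 gt_eqF.
    apply: ler_wpM2l; first by rewrite divr_ge0 ?mulrn_wge0 ?ltW.
    by apply: le_trans (expR_ge1Dx _); rewrite lerDr.
  - exact: cvg_cst.
  - rewrite -[X in _ --> X](mulr0 (s ^+ 2 *+ 2)).
    apply: cvgM; first exact: cvg_cst.
    apply/gtr0_cvgV0; last exact: cvgr_idn.
    by near=> n; rewrite ltr0n; near: n; exact: nbhs_infty_gt.
have L1 := cvg_itv h0 ch.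
have L2 : (\int[mu]_(x in itv n) (h x)%:E)%E @[n --> \oo] --> (0%:E + K%:E * 1)%E.
  apply: (@cvg_trans _ ((F (m + n%:R) - F (m - n%:R))%:E +
      K%:E * \int[mu]_(x in itv n) (g x)%:E @[n --> \oo])%E).
    apply: near_eq_cvg; near=> n; apply/esym; apply: hE.
    by near: n; exact: nbhs_infty_gt.
  apply: cvgeD => //; first by apply: cvg_EFin => //; exact: nearW.
  apply: cvgeZl => //; rewrite -(integral_normal_pdf m s).
  apply: cvg_itv; [exact: normal_pdf_ge0|exact: cg].
rewrite -[LHS]/(\int[mu]_x (h x)%:E)%E.
have := cvg_unique _ L1 L2.
rewrite mule1 add0e; exact.
Unshelve. all: by end_near. Qed.
End normal_moment.

(** The Radon-Nikodym derivative of [normal_prob] agrees almost everywhere with the density, as both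
    have the same integral over every measurable set. *)
Lemma integral_normal_prob {R : realType} (m s : R) (f : R -> R) :
  measurable_fun setT f -> (forall x, 0 <= f x) ->
  (\int[normal_prob m s]_x (f x)%:E < +oo)%E ->
  (\int[normal_prob m s]_x (f x)%:E =
   \int[lebesgue_measure]_x ((f x) * normal_pdf m s x)%:E)%E.
Proof.
move=> mf f0 foo.
have mfE : measurable_fun setT (EFin \o f) by exact/measurable_EFinP.
have mpdf : measurable_fun setT (fun x => (normal_pdf m s x)%:E).
  by apply/measurable_EFinP; exact: measurable_normal_pdf.
rewrite -(Radon_Nikodym_change_of_variables (normal_prob_dominates m s))//=;
  last first.
  apply/integrableP; split => //.
  by under eq_integral do rewrite /= ger0_norm//.
apply: ae_eq_integral => //.
- apply: emeasurable_funM => //; apply: measurable_int.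
  by apply: Radon_Nikodym_integrable; exact: normal_prob_dominates.
- by under eq_fun do rewrite EFinM; exact: emeasurable_funM.
- under [X in ae_eq _ _ _ X]eq_fun do rewrite EFinM.
  apply: ae_eqe_mul2l => /=.
  rewrite Radon_NikodymE//=; first exact: normal_prob_dominates.
  move=> abmu; case: cid => /= h [h1 h2 h3].
  apply: integral_ae_eq => //=.
  by move=> E E01 mE; rewrite -h3.
Qed.

(** * Identifying centred Gaussian laws by second moments *)

Section gaussian_moments.
Context {R : realType} d (T : measurableType d) (P : probability T R).

(** Second moments about every [c] encode mean and variance at once: comparing [c = 0] with [c = m]
    forces the mean [m] to vanish. A point mass then has [v = 0]. *)
Lemma gaussian_law_moments (X : T -> R) (v : R) :
  measurable_fun setT X -> gaussian_law (pushforward P X) ->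
  (forall c, (\int[P]_w ((X w - c) ^+ 2)%:E = (v + c ^+ 2)%:E)%E) ->
  (v = 0 /\ forall A, measurable A -> P (X @^-1` A) = \d_(0:R) A) \/
  (exists s, [/\ s != 0, s ^+ 2 = v &
    forall A, measurable A -> P (X @^-1` A) = normal_prob 0 s A]).
Proof.
move=> mX gX Xv.
have msq c : measurable_fun setT (fun x : R => (x - c) ^+ 2).
  by apply: measurable_funX; exact: measurable_funB.
pose PX := @pushforward _ _ T (measurableTypeR R) R P X.
have mX' : measurable_fun setT (X : T -> measurableTypeR R) by exact: mX.
have key c : (\int[PX]_x ((x - c) ^+ 2)%:E = (v + c ^+ 2)%:E)%E.
  rewrite /PX (@ge0_integral_pushforward _ _ T (measurableTypeR R) R X mX' P setT
    (fun x => ((x - c) ^+ 2)%:E) measurableT) ?preimage_setT.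
  - exact: Xv.
  - apply/measurable_EFinP; exact: msq.
  - by move=> x _; rewrite lee_fin sqr_ge0.
case: gX => [[m [s [s0 law]]]|[m law]]; [right|left].
- have E c : s ^+ 2 + (m - c) ^+ 2 = v + c ^+ 2.
    apply/EFin_inj; rewrite -key.
    have Es : (\int[PX]_x ((x - c) ^+ 2)%:E =
        \int[normal_prob m s]_x ((x - c) ^+ 2)%:E)%E.
      rewrite /PX; apply: eq_measure_integral => A mA _; exact: law.
    rewrite Es integral_normal_prob ?normal_pdf_second_moment//.
      by move=> x; exact: sqr_ge0.
    by rewrite -Es key ltry.
  have m0 : m = 0.
    have := E 0; have := E m; rewrite subrr subr0 expr0n /= addr0 => -> /eqP.
    rewrite addr0 -addrA -subr_eq0 addrAC subrr add0r -mulr2n mulrn_eq0 /=.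
    by rewrite sqrf_eq0 => /eqP.
  exists s; split; first exact: s0.
    by have := E m; rewrite m0 subrr expr0n/= !addr0.
  by move=> A mA; rewrite -m0 -law.
- have E c : (m - c) ^+ 2 = v + c ^+ 2.
    apply/EFin_inj; rewrite -key.
    have -> : (\int[PX]_x ((x - c) ^+ 2)%:E =
        \int[\d_(m : measurableTypeR R)]_x ((x - c) ^+ 2)%:E)%E.
      by rewrite /PX; apply: eq_measure_integral => A mA _; exact: law.
    rewrite integral_dirac//= ?diracT ?mul1e//.
    by apply/measurable_EFinP; exact: msq.
  have := E m; rewrite subrr expr0n /= => vE.
  have := E 0; rewrite subr0 expr0n /= addr0 => vE'.
  have v0 : v = 0.
    apply/eqP; rewrite eq_le -[X in _ && (_ <= X)]vE' sqr_ge0 andbT.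
    by rewrite -(lerD2r (m ^+ 2)) -vE add0r sqr_ge0.
  have m0 : m = 0 by apply/eqP; rewrite -sqrf_eq0 vE' v0.
  split => // A mA; rewrite -m0 -law//.
Qed.

End gaussian_moments.

(** * Two-sided Gaussian tail bounds *)

Section normal_tail.
Context {R : realType}.
Notation mu := (@lebesgue_measure R).
Variables (s t : R).
Hypotheses (s0 : s != 0) (t0 : 0 < t).

Let g x : R := normal_pdf 0 s x.

Let gE x : g x = normal_peak s * expR (- x ^+ 2 / (s ^+ 2 *+ 2)).
Proof. by rewrite /g normal_pdfE// /normal_fun subr0. Qed.

(** Mills' bound: beyond [t] the density is at most [x / t] times itself, and this product has an
    explicit antiderivative. *)
Lemma normal_tail_le : (normal_prob 0 s `]t, +oo[ <=
  (s ^+ 2 / t * normal_pdf 0 s t)%:E)%E.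
Proof.
pose F x : R := - (s ^+ 2 / t * g x).
pose f x : R := x / t * g x.
have derF (x : R) : is_derive x 1 F (f x).
  have -> : F = fun x => - (s ^+ 2 / t *
      (normal_peak s * expR (- x ^+ 2 / (s ^+ 2 *+ 2)))).
    by apply/funext => y; rewrite -gE.
  apply: is_derive_eq; rewrite /GRing.scale /= /f gE -mulr_natr.
  by field; rewrite s0 gt_eqF.
have dF (x : R) : derivable F x 1 by case: (derF x).
have cF : continuous F.
  by move=> x; apply: differentiable_continuous; apply/derivable1_diffP.
have cf : continuous f.
  move=> x; apply: cvgM; last exact: continuous_normal_pdf.
  by apply: cvgM; [exact: cvg_id|exact: cvg_cst].
have Foo : F x @[x --> +oo] --> (0 : R).
  have s20 : 0 < s ^+ 2 by rewrite exprn_even_gt0.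
  have -> : F = fun x => - (s ^+ 2 / t * normal_peak s) *
      expR (- (x ^+ 2 / (s ^+ 2 *+ 2))).
    apply/funext => x; rewrite /F gE (_ : - x ^+ 2 / _ = - (x ^+ 2 / (s ^+ 2 *+ 2)));
      [ring|by rewrite mulNr].
  rewrite -[X in _ --> X](mulr0 (- (s ^+ 2 / t * normal_peak s))).
  apply: cvgM; first exact: cvg_cst.
  apply: (@squeeze_cvgr _ _ _ _ (cst 0) (fun x => (s ^+ 2 *+ 2) * x^-1)).
  - near=> x.
    have x1 : 1 <= x by near: x; exact: nbhs_pinfty_ge.
    have x0 : 0 < x by exact: lt_le_trans x1.
    apply/andP; split; first exact: expR_ge0.
    rewrite expRN -[leRHS]invf_div lef_pV2 ?posrE ?divr_gt0 ?expR_gt0//;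
      last by rewrite pmulrn_lgt0.
    apply: (@le_trans _ _ (x ^+ 2 / (s ^+ 2 *+ 2))).
      apply: ler_wpM2r; first by rewrite invr_ge0 mulrn_wge0 ?ltW.
      by rewrite expr2 ler_peMr ?(ltW x0).
    by apply: le_trans (expR_ge1Dx _); rewrite lerDr.
  - exact: cvg_cst.
  - rewrite -[X in _ --> X](mulr0 (s ^+ 2 *+ 2)).
    apply: cvgM; first exact: cvg_cst.
    by apply/gtr0_cvgV0; [exact: nbhs_pinfty_gt|exact: cvg_id].
have mf : measurable_fun `]t, +oo[ f.
  by apply: measurable_funTS; exact: continuous_measurable_fun.
have FTC : (\int[mu]_(x in `[t, +oo[) (f x)%:E = 0%:E - (F t)%:E)%E.
  apply: ge0_continuous_FTC2y.
  - move=> x tx; rewrite mulr_ge0 ?normal_pdf_ge0// divr_ge0 ?(ltW t0)//.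
    by apply: le_trans tx; exact: ltW.
  - exact: continuous_subspaceT.
  - exact: Foo.
  - by move=> x _; exact: dF.
  - by apply: cvg_at_right_filter; exact: cF.
  - by move=> x _; rewrite derive1E; case: (derF x).
have <- : (\int[mu]_(x in `]t, +oo[) (f x)%:E = (s ^+ 2 / t * g t)%:E)%E.
  rewrite integral_itv_obnd_cbnd; last by apply/measurable_EFinP.
  by rewrite FTC sub0e -EFinN opprK.
rewrite /normal_prob; apply: ge0_le_integral => //.
- by move=> x _; rewrite lee_fin normal_pdf_ge0.
- apply/measurable_EFinP; apply: measurable_funTS; exact: measurable_normal_pdf.
- apply/measurable_EFinP; apply: measurable_funTS.
  exact: continuous_measurable_fun.
- move=> x; rewrite /= in_itv/= andbT => tx; rewrite lee_fin ler_peMl//.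
    exact: normal_pdf_ge0.
  by rewrite ler_pdivlMr// mul1r ltW.
Unshelve. all: by end_near. Qed.

(** The density decreases on the positive axis, so a rectangle of width [h] fits below it. *)
Lemma normal_tail_ge (h : R) : 0 <= h ->
  ((h * normal_pdf 0 s (t + h))%:E <= normal_prob 0 s `]t, +oo[)%E.
Proof.
move=> h0; rewrite /normal_prob.
refine (@le_trans _ _ (\int[mu]_(x in `]t, (t + h)%R]) (normal_pdf 0 s x)%:E)%E _ _ _ _).
  apply: (@le_trans _ _
    (\int[mu]_(x in `]t, (t + h)%R]) (normal_pdf 0 s (t + h))%:E)%E).
    rewrite integral_cst//= lebesgue_measure_itv/= lte_fin ltrDl.
    rewrite [(_ * _)%R]mulrC.
    case: ltP => h0'; first by rewrite -EFinB addrAC subrr add0r EFinM.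
    by have -> : h = 0 by apply/le_anti; rewrite h0 h0'.
  apply: ge0_le_integral => //.
  - by move=> x _; rewrite lee_fin normal_pdf_ge0.
  - apply/measurable_EFinP; apply: measurable_funTS; exact: measurable_normal_pdf.
  - move=> x; rewrite /= in_itv/= => /andP[tx xh]; rewrite lee_fin -!/(g _) !gE.
    rewrite ler_wpM2l ?normal_peak_ge0// ler_expR ler_wpM2r//.
      by rewrite invr_ge0 mulrn_wge0// sqr_ge0.
    have x0 : 0 < x by exact: lt_trans tx.
    by rewrite lerN2 !expr2; apply: ler_pM => //; exact: ltW.
apply: ge0_subset_integral => //.
- apply/measurable_EFinP; apply: measurable_funTS; exact: measurable_normal_pdf.
- by move=> x _; rewrite lee_fin normal_pdf_ge0.
- by move=> x; rewrite /= !in_itv/= andbT => /andP[].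
Qed.

End normal_tail.

Lemma fin_num_normal_prob_itv {R : realType} (m s t : R) :
  normal_prob m s `]t, +oo[ \is a fin_num.
Proof.
have mt : measurable (`]t, +oo[%classic : set (measurableTypeR R)).
  exact: measurable_itv.
exact: (fin_num_measure (normal_prob m s) _ mt).
Qed.

Section gaussian_tail.
Context {R : realType} d (T : measurableType d) (P : probability T R).
Variables (X : T -> R) (v : R).
Hypothesis mX : measurable_fun setT X.
Hypothesis gX : gaussian_law (pushforward P X).
Hypothesis Xv :
  forall c, (\int[P]_w ((X w - c) ^+ 2)%:E = (v + c ^+ 2)%:E)%E.

(** The cap [4 <= 2 pi] makes the prefactor [s / sqrt (2 pi)] at most 1. Bounding through a positive
    [v'] also covers the degenerate case [v = 0]. *)
Lemma gaussian_tail_le (t v' : R) : 0 < t -> 0 < v' -> v <= v' -> v' <= 4 ->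
  fine (P [set w | t < X w]) <= t^-1 * expR (- (t ^+ 2 / (2 * v'))).
Proof.
move=> t0 v'0 vv' v'4; have v4 : v <= 4 by exact: le_trans v'4.
have -> : [set w | t < X w] = X @^-1` `]t, +oo[%classic.
  by apply/seteqP; split => w /=; rewrite in_itv/= andbT.
have [[v0 ->//]|[s [s0 sv ->//]]] := gaussian_law_moments mX gX Xv.
  rewrite diracE memNset /= ?in_itv/= ?andbT ?mulr_ge0 ?invr_ge0 ?expR_ge0 ?ltW//.
  by apply/negP; rewrite -leNgt ltW.
apply: (@le_trans _ _ (t^-1 * expR (- (t ^+ 2 / (2 * v))))); last first.
  have v0 : 0 < v by rewrite -sv exprn_even_gt0.
  apply: ler_wpM2l; first by rewrite invr_ge0 ltW.
  rewrite ler_expR lerN2; apply: ler_wpM2l; first exact: sqr_ge0.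
  by rewrite lef_pV2 ?posrE ?mulr_gt0// ler_pM2l.
rewrite -lee_fin fineK; last exact: fin_num_normal_prob_itv.
apply: le_trans (normal_tail_le s0 t0) _; rewrite lee_fin.
have s20 : 0 < s ^+ 2 by rewrite exprn_even_gt0.
rewrite normal_pdfE// /normal_fun subr0.
have -> : - t ^+ 2 / (s ^+ 2 *+ 2) = - (t ^+ 2 / (2 * v)).
  by rewrite -sv mulNr -mulr_natl.
rewrite mulrA ler_wpM2r ?expR_ge0// mulrAC ler_piMl ?invr_ge0 ?(ltW t0)//.
rewrite /normal_peak ler_pdivrMr ?mul1r; last first.
  by rewrite sqrtr_gt0 mulrn_wgt0// mulr_gt0// pi_gt0.
rewrite -[leLHS]ger0_norm ?(ltW s20)// -sqrtr_sqr ler_sqrt; last first.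
  by rewrite mulrn_wge0 // mulr_ge0 ?pi_ge0 ?(ltW s20).
have pi2 := @pi_ge2 R.
rewrite -mulr_natr -mulrA [leLHS]expr2 ler_pM2l// sv; lra.
Qed.

(** A rectangle of width [1 / t] costs at most [(2 + t^-2) / (2 v) <= 3] in the exponent, and
    [v <= 4] keeps the peak of the density above [1 / 6]. *)
Lemma gaussian_tail_ge (t : R) : 1 <= t -> 2^-1 <= v -> v <= 4 ->
  expR (- 3) / 6 * (t^-1 * expR (- (t ^+ 2 / (2 * v)))) <=
  fine (P [set w | t < X w]).
Proof.
move=> t1 v1 v4; have t0 : 0 < t by exact: lt_le_trans t1.
have -> : [set w | t < X w] = X @^-1` `]t, +oo[%classic.
  by apply/seteqP; split => w /=; rewrite in_itv/= andbT.
have [[v0 _]|[s [s0 sv ->//]]] := gaussian_law_moments mX gX Xv.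
  by move: v1; rewrite v0; lra.
rewrite -lee_fin fineK; last exact: fin_num_normal_prob_itv.
have ti0 : 0 <= t^-1 by rewrite invr_ge0 ltW.
apply: le_trans (normal_tail_ge s0 t0 ti0); rewrite lee_fin.
have s20 : 0 < s ^+ 2 by rewrite exprn_even_gt0.
have v0 : 0 < v by rewrite -sv.
rewrite normal_pdfE// /normal_fun subr0.
have pk : 6^-1 <= normal_peak s.
  rewrite lef_pV2 ?posrE//; last first.
    by rewrite sqrtr_gt0 mulrn_wgt0// mulr_gt0// pi_gt0.
  rewrite -[leRHS]ger0_norm// -sqrtr_sqr ler_sqrt ?sqr_ge0//.
  have pi4 := @pihalf_lt2 R; have pi2 := @pi_ge2 R.
  by rewrite -mulr_natr sv; nra.
have ee : expR (-3) * expR (- (t ^+ 2 / (2 * v))) <=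
    expR (- (t + t^-1) ^+ 2 / (s ^+ 2 *+ 2)).
  rewrite -expRD ler_expR -[s ^+ 2 *+ 2]mulr_natr sv mulNr (mulrC v) -opprD lerN2.
  rewrite -[X in _ <= X + _](mulfK (_ : 2 * v != 0)) ?gt_eqF ?mulr_gt0//.
  rewrite -mulrDl ler_pM2r ?invr_gt0 ?mulr_gt0//.
  have tt : t * t^-1 = 1 by rewrite divff// gt_eqF.
  have t1' : t^-1 <= 1 by rewrite invf_le1.
  nra.
have e0 := expR_ge0 (- (t ^+ 2 / (2 * v))).
have e3 := expR_ge0 (- 3 : R).
rewrite (_ : _ / 6 * _ = t^-1 * (6^-1 * (expR (-3) *
  expR (- (t ^+ 2 / (2 * v)))))); last by ring.
rewrite ler_wpM2l// ler_pM// mulr_ge0//.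
Qed.

End gaussian_tail.

(** * Linear combinations of the process *)

Section lincomb.
Context {R : realType} {d : measure_display} {T : measurableType d}.
Variables (P : probability T R) (Z : R -> {RV P >-> R}) (r : R -> R).
Hypothesis Zr : std_stationary_gaussian Z r.

Let mZ t : measurable_fun setT (Z t : T -> R).
Proof. exact: measurable_funPT. Qed.

Let E0 t : ('E_P[Z t] = 0)%E.
Proof. by case: Zr. Qed.

Let cov s t : (\int[P]_w (Z s w * Z t w)%:E = (r (t - s))%:E)%E.
Proof.
case: Zr => _ _ _ /(_ s t) + _; rewrite covariance.unlock !E0 /= => <-.
rewrite expectation_def; apply: eq_integral => w _ /=.
by rewrite !subr0.
Qed.

Lemma stationary_cov0 : r 0 = 1.
Proof.
case: Zr => _ _ /(_ 0) V1 /(_ 0 0) + _; rewrite -[covariance _ _ _]/(variance P (Z 0)).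
by rewrite V1 subrr => -[].
Qed.

Lemma stationary_covN t : r (- t) = r t.
Proof.
apply/EFin_inj; rewrite -[- t]sub0r -[in RHS](subr0 t) -!cov.
by apply: eq_integral => w _; rewrite mulrC.
Qed.

Let isq t : P.-integrable setT (fun w => (Z t w * Z t w)%:E).
Proof.
apply/integrableP; split.
  by apply/measurable_EFinP; apply: measurable_funM; exact: mZ.
under eq_integral do rewrite /= ger0_norm ?(sqr_ge0, mulr_ge0) -?expr2 ?sqr_ge0//.
by rewrite (eq_integral (fun w => (Z t w * Z t w)%:E)) ?cov ?ltry.
Qed.

Let iprod s t : P.-integrable setT (fun w => (Z s w * Z t w)%:E).
Proof.
apply: (@le_integrable _ _ _ _ _ measurableT _
  (fun w => ((Z s w * Z s w)%:E + (Z t w * Z t w)%:E)%E)).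
- by apply/measurable_EFinP; apply: measurable_funM; exact: mZ.
- move=> w _; rewrite -EFinD lee_fin [leRHS]ger0_norm -?expr2 ?addr_ge0 ?sqr_ge0//.
  have h1 := sqr_ge0 (Z s w - Z t w); have h2 := sqr_ge0 (Z s w + Z t w).
  by rewrite ler_norml; apply/andP; split; nra.
- by apply: integrableD => //; exact: isq.
Qed.

Let iZ t : P.-integrable setT (fun w => (Z t w)%:E).
Proof.
apply: (@le_integrable _ _ _ _ _ measurableT _
  (fun w => ((cst 1 w)%:E + (Z t w * Z t w)%:E)%E)).
- by apply/measurable_EFinP; exact: mZ.
- move=> w _; rewrite -EFinD lee_fin /= [leRHS]ger0_norm -?expr2 ?addr_ge0 ?sqr_ge0//.
  have h1 := sqr_ge0 (Z t w - 1); have h2 := sqr_ge0 (Z t w + 1).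
  by rewrite ler_norml; apply/andP; split; nra.
- apply: integrableD => //.
  exact: finite_measure_integrable_cst.
Qed.

Definition lincomb n (a x : 'I_n -> R) (w : T) : R := \sum_(i < n) a i * Z (x i) w.

Definition lincomb_var n (a x : 'I_n -> R) : R :=
  \sum_(i < n) \sum_(j < n) a i * a j * r (x j - x i).

Lemma measurable_lincomb n (a x : 'I_n -> R) : measurable_fun setT (lincomb a x).
Proof.
by apply: measurable_sum => i; apply: measurable_funM => //; exact: mZ.
Qed.

(** The shift by [c] has the form that [gaussian_law_moments] asks for; the cross term vanishes
    because the process is centred. *)
Lemma lincomb_second_moment n (a x : 'I_n -> R) (c : R) :
  (\int[P]_w ((lincomb a x w - c) ^+ 2)%:E = (lincomb_var a x + c ^+ 2)%:E)%E.
Proof.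
pose f w := (\sum_(i < n) \sum_(j < n) (a i * a j)%:E * (Z (x i) w * Z (x j) w)%:E)%E.
pose g w := (\sum_(i < n) (- 2 * c * a i)%:E * (Z (x i) w)%:E)%E.
have If i j : P.-integrable setT
    (fun w => ((a i * a j)%:E * (Z (x i) w * Z (x j) w)%:E)%E).
  by apply: integrableZl => //; exact: iprod.
have Ig i : P.-integrable setT (fun w => ((- 2 * c * a i)%:E * (Z (x i) w)%:E)%E).
  by apply: integrableZl => //; exact: iZ.
have Ifs i : P.-integrable setT (fun w => (\sum_(j < n)
    (a i * a j)%:E * (Z (x i) w * Z (x j) w)%:E)%E).
  by apply: integrable_sum => // j _; exact: If.
transitivity (\int[P]_w (f w + g w + (cst (c ^+ 2) w)%:E))%E.
  apply: eq_integral => w _; rewrite /f /g.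
  under eq_bigr do (under eq_bigr do rewrite -EFinM; rewrite sumEFin).
  under [X in (_ + X + _)%E]eq_bigr do rewrite -EFinM.
  rewrite !sumEFin -!EFinD; congr EFin; rewrite sqrrB /lincomb.
  congr (_ + _ + _).
    2: by rewrite -mulr_natl mulr_suml mulr_sumr -sumrN; apply: eq_bigr => i _; ring.
  rewrite expr2 mulr_suml; apply: eq_bigr => i _; rewrite mulr_sumr.
  by apply: eq_bigr => j _; ring.
have cstI : P.-integrable setT (fun w => (cst (c ^+ 2) w)%:E).
  exact: finite_measure_integrable_cst.
have cstE : (\int[P]_w (cst (c ^+ 2) w)%:E = (c ^+ 2)%:E)%E.
  transitivity ('E_P[cst (c ^+ 2)%R])%E; last exact: expectation_cst.
  by rewrite expectation.unlock.
have fI : P.-integrable setT f by apply: integrable_sum => // i _; exact: Ifs.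
have gI : P.-integrable setT g by apply: integrable_sum => // i _; exact: Ig.
rewrite integralD//=; last exact: integrableD.
rewrite integralD// cstE /f /g.
rewrite integral_sum//=.
rewrite integral_sum//=.
rewrite [X in (_ + X + _)%E]big1 ?adde0; last first.
  move=> i _; rewrite integralZl//.
  by rewrite -expectation_def E0 mule0.
rewrite EFinD; congr (_ + _)%E.
rewrite /lincomb_var -sumEFin; apply: eq_bigr => i _.
rewrite integral_sum//= -sumEFin; apply: eq_bigr => j _.
rewrite integralZl//.
by rewrite cov -EFinM.
Qed.

Let glincomb n (a x : 'I_n -> R) : gaussian_law (pushforward P (lincomb a x)).
Proof. by case: Zr => + _ _ _ _; exact. Qed.

Lemma lincomb_tail_le n (a x : 'I_n -> R) (t v : R) : 0 < t -> 0 < v ->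
  lincomb_var a x <= v -> v <= 4 ->
  fine (P [set w | t < lincomb a x w]) <= t^-1 * expR (- (t ^+ 2 / (2 * v))).
Proof.
apply: gaussian_tail_le; [exact: measurable_lincomb|exact: glincomb|].
exact: lincomb_second_moment.
Qed.

Lemma lincomb_tail_ge n (a x : 'I_n -> R) (t : R) : 1 <= t ->
  2^-1 <= lincomb_var a x -> lincomb_var a x <= 4 ->
  expR (- 3) / 6 * (t^-1 * expR (- (t ^+ 2 / (2 * lincomb_var a x)))) <=
  fine (P [set w | t < lincomb a x w]).
Proof.
apply: gaussian_tail_ge; [exact: measurable_lincomb|exact: glincomb|].
exact: lincomb_second_moment.
Qed.

End lincomb.

(** * Bonferroni's inequality *)

Section prob.
Context {R : realType} {d : measure_display} {T : measurableType d}.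
Variable P : probability T R.
Notation pr A := (fine (P A)).

Let fin A : measurable A -> P A \is a fin_num.
Proof. by move=> mA; apply: fin_num_measure. Qed.

Lemma pr_le (A B : set T) : measurable A -> measurable B -> A `<=` B -> pr A <= pr B.
Proof.
move=> mA mB AB; apply: fine_le; [exact: fin|exact: fin|].
by apply: le_measure => //; rewrite inE.
Qed.

Lemma prU (A B : set T) : measurable A -> measurable B ->
  pr (A `|` B) = pr A + pr B - pr (A `&` B).
Proof.
move=> mA mB; rewrite measureUfinr//; last by rewrite -ge0_fin_numE ?fin.
have mI : measurable (A `&` B) by exact: measurableI.
by rewrite fineB ?fineD ?fin// fin_numD !fin.
Qed.

Lemma pr_ge0 (A : set T) : 0 <= pr A.
Proof. by rewrite fine_ge0. Qed.

Lemma prU_le (A B : set T) : measurable A -> measurable B ->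
  pr (A `|` B) <= pr A + pr B.
Proof. by move=> mA mB; rewrite prU// gerBl pr_ge0. Qed.

Lemma pr_bigU_le (A : nat -> set T) n : (forall i, measurable (A i)) ->
  pr (\big[setU/set0]_(i < n) A i) <= \sum_(i < n) pr (A i).
Proof.
move=> mA; elim: n => [|n IHn]; first by rewrite !big_ord0 measure0.
rewrite !big_ord_recr /=; apply: le_trans (prU_le _ _) _ => //.
  exact: bigsetU_measurable.
by rewrite lerD2r.
Qed.

(** Pairs are grouped by their later index, so that the induction adds one event and one summand at
    a time. *)
Lemma bonferroni_ge (A : nat -> set T) n : (forall i, measurable (A i)) ->
  \sum_(j < n) (pr (A j) - \sum_(i < j) pr (A i `&` A j)) <=
  pr (\big[setU/set0]_(i < n) A i).
Proof.
move=> mA; elim: n => [|n IHn]; first by rewrite !big_ord0 pr_ge0.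
rewrite !big_ord_recr /= prU//; last exact: bigsetU_measurable.
rewrite -[leRHS]addrA lerD// lerD2l lerN2 big_distrl /=.
apply: (@pr_bigU_le (fun i => A i `&` A n)) => i; exact: measurableI.
Qed.

End prob.

(** * The supremum event and its measurability *)

Section sup.
Context {R : realType} {d : measure_display} {T : measurableType d}.
Variables (P : probability T R) (Z : R -> {RV P >-> R}) (h : R).
Hypotheses (cZ : continuous_paths Z) (h0 : 0 < h).

(** Path continuity on a compact interval gives [has_sup], without which [sup] would be a default
    value. *)
Lemma sup_exceedsE (u : R) (w : T) :
  sup_exceeds Z h u w <-> exists2 t, t \in `[0, h] & u < Z t w.
Proof.
have c0 : {within `[0, h], continuous (fun t => Z t w)}.
  by apply: continuous_subspaceT; exact: cZ.
have [c c0h cM] := EVT_max (ltW h0) c0.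
have hs : has_sup [set Z t w | t in `[0, h]].
  split; first by exists (Z 0 w), 0 => //=; rewrite in_itv/= lexx ltW.
  by exists (Z c w) => _ [t /= th <-]; exact: cM.
rewrite /sup_exceeds; split => /= [|[t th ut]].
  by move/(sup_gt hs.1) => [_ [t th <-] ut]; exists t.
by apply: lt_le_trans ut _; exact: (sup_upper_bound hs (ex_intro2 _ _ t th erefl)).
Qed.

Lemma measurable_gt (X : T -> R) (u : R) : measurable_fun setT X ->
  measurable [set w | u < X w].
Proof.
move=> mX; rewrite -[X in measurable X]setTI.
have -> : [set w | u < X w] = X @^-1` `]u, +oo[%classic.
  by apply/seteqP; split => w /=; rewrite in_itv/= andbT.
by apply: mX => //; exact: measurable_itv.
Qed.

(** By continuity an exceedance persists for a short while, hence occurs at a rational time, and the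
    union becomes countable. *)
Lemma measurable_sup_exceeds (u : R) : measurable (sup_exceeds Z h u).
Proof.
have -> : sup_exceeds Z h u = \bigcup_(q : rat)
    (if (ratr q : R) \in `[0, h] then [set w | u < Z (ratr q) w] else set0).
  apply/seteqP; split => w.
    move/sup_exceedsE => [t]; rewrite in_itv/= => /andP[t0 th] ut.
    have ct : (fun s => Z s w) @ t --> Z t w by exact: cZ.
    have /ct/nbhs_ballP[e /= e0 eP] : nbhs (Z t w) [set y | u < y].
      by apply: open_nbhs_nbhs; split => //; exact: open_gt.
    have lt1 : Num.max 0 (t - e) < Num.min h (t + e).
      rewrite lt_min !gt_max; apply/andP; split; apply/andP; split => //; lra.
    have [q] := rat_in_itvoo lt1.
    rewrite in_itv/= lt_min gt_max => /andP[/andP[q0 q1] /andP[q2 q3]].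
    exists q => //; rewrite in_itv/= (ltW q0) (ltW q2)/=.
    by apply: eP; rewrite /ball/= ltr_norml; lra.
  move=> [q _]; case: ifP => // qh /= uq; apply/sup_exceedsE.
  by exists (ratr q).
apply: countable_bigcupT_measurable => [|q]; first exact: countableP.
case: ifP => _; last exact: measurable0.
apply: measurable_gt; exact: measurable_funPT.
Qed.

End sup.

(** * From events on a mesh to a lower bound for the constant *)

Section master.
Context {R : realType} {d : measure_display} {T : measurableType d}.
Variables (P : probability T R) (Z : R -> {RV P >-> R}) (r : R -> R).
Variables (alpha C h H : R).
Hypothesis Zr : std_stationary_gaussian Z r.
Hypotheses (alpha0 : 0 < alpha) (C0 : 0 < C) (h0 : 0 < h).
Hypothesis r_o : (fun t : R => r t - (1 - C * `|t| `^ alpha)) =o_ (0 : R)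
  (fun t : R => `|t| `^ alpha).
Hypothesis r_loc : forall t, 0 < t <= h -> 4 / 5 * (C * t `^ alpha) <= 1 - r t.
Hypothesis HH : pickands_theorem_for alpha H.
Notation pr A := (fine (P A)).

Definition mesh (u : R) : R := u `^ (- (2 / alpha)).

Lemma mesh_gt0 u : 0 < u -> 0 < mesh u.
Proof. exact: powR_gt0. Qed.

Let covh : pickands_covariance alpha C h r.
Proof.
split=> // eps eps0.
have [-> |/set0P S0] := eqVneq [set r t | t in `[eps, h]] set0.
  by rewrite sup0 ltr01.
apply: (@le_lt_trans _ _ (1 - 4 / 5 * (C * eps `^ alpha))); last first.
  by rewrite ltrBlDr ltrDl !mulr_gt0 ?powR_gt0.
apply: ge_sup => // _ [t /= + <-]; rewrite in_itv/= => /andP[et th].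
have t0 : 0 < t by exact: lt_le_trans et.
have : 4 / 5 * (C * t `^ alpha) <= 1 - r t by apply: r_loc; rewrite t0.
have : C * eps `^ alpha <= C * t `^ alpha.
  apply: ler_wpM2l; first exact: ltW.
  by apply: ge0_ler_powR; rewrite ?nnegrE ?(ltW alpha0) ?(ltW eps0) ?(ltW t0).
lra.
Qed.

(** After normalisation by [u * expR (u^2 / 2)], each event contributes at least [p] minus its
    overlaps with earlier events, so at least [p / 2]. About [h / (a * mesh u)] sites fit into
    [[0, h]], which gives [h p / (2 a)] as a lower bound for the limit. *)
Lemma pickands_lower_bound (a p : R) (b : nat -> R) (A : R -> nat -> set T) :
  0 < a -> 0 < p ->
  (forall u j, measurable (A u j)) ->
  (forall u j, A u j `<=` [set w | u < Z (j%:R * (a * mesh u)) w]) ->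
  (\forall u \near +oo, forall j, p <= u * expR (u ^+ 2 / 2) * pr (A u j)) ->
  (\forall u \near +oo, forall i j, (i < j)%N -> j%:R * (a * mesh u) <= h ->
    u * expR (u ^+ 2 / 2) * pr (A u i `&` A u j) <= b (j - i)%N) ->
  (forall n, \sum_(i < n) b i.+1 <= p / 2) ->
  p <= H * (a * C `^ alpha^-1).
Proof.
move=> a0 p0 mA AZ pA bA bp.
have cZ : continuous_paths Z by case: Zr.
have := HH C0 h0 Zr covh; set f := (F in F @ _ --> _) => fH.
have lb : \forall u \near +oo, h * p / (2 * a) <= f u.
  near=> u.
  have u0 : 0 < u by near: u; exact: nbhs_pinfty_gt.
  have hA : forall j, p <= u * expR (u ^+ 2 / 2) * pr (A u j) by near: u.
  have hB : forall i j, (i < j)%N -> j%:R * (a * mesh u) <= h ->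
    u * expR (u ^+ 2 / 2) * pr (A u i `&` A u j) <= b (j - i)%N by near: u.
  (* The successor makes [N] steps cover [h], while every site of index below [N] still lies in
     [[0, h]]. *)
  pose N := (Num.truncn (h / (a * mesh u))).+1.
  have m0 := mesh_gt0 u0.
  have am0 : 0 < a * mesh u by rewrite mulr_gt0.
  have Nh : h <= N%:R * (a * mesh u).
    by rewrite -ler_pdivrMr// ltW// truncnS_gt.
  have jh j : (j < N)%N -> j%:R * (a * mesh u) <= h.
    rewrite ltnS => jN; rewrite -ler_pdivlMr// -truncn_ge_nat//.
    by rewrite divr_ge0 ?ltW.
  have E0 : 0 < u * expR (u ^+ 2 / 2) by rewrite mulr_gt0 ?expR_gt0.
  have -> : f u = mesh u * (u * expR (u ^+ 2 / 2) * pr (sup_exceeds Z h u)).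
    rewrite /f /mesh powRD; last by rewrite (gt_eqF u0) implybT.
    by rewrite powRr1 ?ltW//; ring.
  have sub : \big[setU/set0]_(j < N) A u j `<=` sup_exceeds Z h u.
    move=> w; rewrite -bigcup_mkord => -[j /= jN /AZ /= uZ].
    apply/(sup_exceedsE cZ h0); exists (j%:R * (a * mesh u)) => //.
    by rewrite in_itv/= jh// andbT mulr_ge0// (ltW am0).
  have bonf := bonferroni_ge P N (mA u).
  have prs : pr (\big[setU/set0]_(j < N) A u j) <= pr (sup_exceeds Z h u).
    apply: pr_le => //; first exact: bigsetU_measurable.
    exact: measurable_sup_exceeds.
  have pterm j : (j < N)%N -> p / 2 <= u * expR (u ^+ 2 / 2) *
      (pr (A u j) - \sum_(i < j) pr (A u i `&` A u j)).
    move=> jN; rewrite mulrBr; have h1 := hA j.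
    have h2 : u * expR (u ^+ 2 / 2) * (\sum_(i < j) pr (A u i `&` A u j)) <= p / 2.
      apply: le_trans (bp j); rewrite mulr_sumr.
      (* Reversing the order turns the lag [j - i] into a successor index. *)
      rewrite [leRHS](reindex_inj rev_ord_inj) /=.
      apply: ler_sum => i _; rewrite subnSK//.
      exact: hB (ltn_ord i) (jh _ jN).
    lra.
  have tot : N%:R * (p / 2) <= u * expR (u ^+ 2 / 2) * pr (sup_exceeds Z h u).
    apply: (@le_trans _ _ (u * expR (u ^+ 2 / 2) *
        \sum_(j < N) (pr (A u j) - \sum_(i < j) pr (A u i `&` A u j)))).
      rewrite mulr_sumr mulr_natl -[X in _ *+ X]card_ord -sumr_const.
      by apply: ler_sum => j _; apply: pterm.
    by apply: ler_wpM2l; [exact: ltW|exact: le_trans prs].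
  apply: (@le_trans _ _ (mesh u * (N%:R * (p / 2)))); last first.
    by apply: ler_wpM2l => //; exact: ltW.
  rewrite ler_pdivrMr ?mulr_gt0//.
  have -> : mesh u * (N%:R * (p / 2)) * (2 * a) = N%:R * (a * mesh u) * p by field.
  by apply: ler_wpM2r => //; exact: ltW.
have := cvgr_to_ge fH lb.
have q0 : 0 < Num.sqrt (2 * pi) :> R by rewrite sqrtr_gt0 mulr_gt0 ?pi_gt0.
(* This factor 2 makes up for the one lost in [p / 2]. *)
have q2 : 2 <= Num.sqrt (2 * pi) :> R.
  rewrite -[leLHS]ger0_norm// -sqrtr_sqr ler_sqrt ?mulr_ge0 ?pi_ge0//.
  have := @pi_ge2 R; lra.
rewrite ler_pdivlMr// mulrAC ler_pdivrMr ?mulr_gt0//.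
have -> : h * C `^ alpha^-1 * H * (2 * a) = h * (2 * (H * (a * C `^ alpha^-1))) by ring.
rewrite -mulrA ler_pM2l//.
set X := H * _; set q := Num.sqrt _ in q0 q2 *; move=> /(_ _) hh.
have := ler_wpM2l (ltW p0) q2; lra.
Unshelve. all: by end_near. Qed.

End master.

(** * Asymptotics of the covariance on the mesh scale *)

Lemma cvg_sum_ord {R : realType} {F : set_system R} {FF : Filter F} n
    (f : 'I_n -> R -> R) (l : 'I_n -> R) :
  (forall i, f i u @[u --> F] --> l i) ->
  \sum_(i < n) f i u @[u --> F] --> \sum_(i < n) l i.
Proof.
elim: n f l => [|n IHn] f l fl.
  by rewrite big_ord0; under eq_fun do rewrite big_ord0; exact: cvg_cst.
rewrite big_ord_recl; under eq_fun do rewrite big_ord_recl.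
by apply: cvgD; [exact: fl|apply: IHn => i; exact: fl].
Qed.

Section asymptotics.
Context {R : realType}.
Variables (r : R -> R) (alpha C : R).
Hypotheses (alpha0 : 0 < alpha) (C0 : 0 < C) (r0 : r 0 = 1).
Hypothesis r_o : (fun t : R => r t - (1 - C * `|t| `^ alpha)) =o_ (0 : R)
  (fun t : R => `|t| `^ alpha).

Let r_near (e : R) : 0 < e -> \forall t \near (0 : R),
  `|1 - r t - C * `|t| `^ alpha| <= e * `|t| `^ alpha.
Proof.
move=> e0; move/eqoP: r_o => /(_ e e0); apply: filterS => t.
rewrite /= (ger0_norm (powR_ge0 _ _)) => /(le_trans _); apply.
by rewrite -normrN le_eqVlt; apply/orP; left; apply/eqP; congr (`| _ |); ring.
Qed.

Lemma cov_local_bound : exists2 h : R, 0 < h &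
  forall t, 0 < t <= h -> 4 / 5 * (C * t `^ alpha) <= 1 - r t.
Proof.
(* An error of [C / 5] in the expansion at 0 leaves the factor [4 / 5]. *)
have e0 : 0 < C / 5 by rewrite divr_gt0.
have /nbhs_ballP[e /= e1 eP] := r_near e0.
exists (e / 2); first by rewrite divr_gt0.
move=> t /andP[t0 te]; have /eP : ball (0 : R) e t.
  rewrite /ball /= sub0r normrN gtr0_norm//; lra.
rewrite /= [`|t|]gtr0_norm// ler_norml => /andP[+ _].
lra.
Qed.

Lemma cvg_mesh : mesh alpha u @[u --> +oo] --> (0 : R).
Proof.
apply/cvgrPdist_le => e e0.
near=> u.
have u0 : 0 < u by near: u; exact: nbhs_pinfty_gt.
rewrite sub0r normrN (gtr0_norm (mesh_gt0 alpha u0)) /mesh powRN.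
rewrite -[leRHS]invrK lef_pV2 ?posrE ?powR_gt0 ?invr_gt0//.
have -> : e^-1 = (e^-1 `^ (alpha / 2)) `^ (2 / alpha).
  rewrite -powRrM (_ : alpha / 2 * (2 / alpha) = 1); last by field; rewrite gt_eqF.
  by rewrite powRr1// invr_ge0 ltW.
have eu : e^-1 `^ (alpha / 2) <= u by near: u; exact: nbhs_pinfty_ge.
by apply: ge0_ler_powR; rewrite ?nnegrE ?powR_ge0 ?(ltW u0) ?divr_ge0 ?(ltW alpha0).
Unshelve. all: by end_near. Qed.

Lemma mesh_powR (u : R) : 0 < u -> mesh alpha u `^ alpha = u ^- 2.
Proof.
move=> u0; rewrite /mesh -powRrM mulNr divfK ?gt_eqF// powRN.
by rewrite powR_mulrn// ltW.
Qed.

(** The mesh is scaled so that its power [alpha] is [u^-2], which makes the local expansion of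
    [1 - r] exactly of order [u^-2]. *)
Lemma cvg_cov_mesh (x : R) :
  u ^+ 2 * (1 - r (x * mesh alpha u)) @[u --> +oo] --> C * `|x| `^ alpha.
Proof.
have [->|x0] := eqVneq x 0.
  rewrite normr0 powR0 ?gt_eqF// mulr0.
  under eq_fun do rewrite mul0r r0 subrr mulr0.
  exact: cvg_cst.
have xa0 : 0 < `|x| `^ alpha by rewrite powR_gt0// normr_gt0.
apply/cvgrPdist_le => e e0.
have cvgt : x * mesh alpha u @[u --> +oo] --> (0 : R).
  by rewrite -(mulr0 x); apply: cvgM; [exact: cvg_cst|exact: cvg_mesh].
have e1 : 0 < e / `|x| `^ alpha by rewrite divr_gt0.
have := cvgt _ (r_near e1); rewrite near_simpl /= => nr.
near=> u.
have u0 : 0 < u by near: u; exact: nbhs_pinfty_gt.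
have : `|1 - r (x * mesh alpha u) - C * `|x * mesh alpha u| `^ alpha|
  <= e / `|x| `^ alpha * `|x * mesh alpha u| `^ alpha by near: u.
have -> : `|x * mesh alpha u| `^ alpha = `|x| `^ alpha * u ^- 2.
  rewrite normrM (gtr0_norm (mesh_gt0 alpha u0)) powRM ?normr_ge0//.
    by rewrite mesh_powR.
  exact: ltW (mesh_gt0 alpha u0).
have u2 : 0 < u ^+ 2 by rewrite exprn_gt0.
have -> : e / `|x| `^ alpha * (`|x| `^ alpha * u ^- 2) = e * u ^- 2.
  by rewrite mulrA divfK// gt_eqF.
rewrite ler_pdivlMr// => /(le_trans _); apply.
have nM A : `|A| * u ^+ 2 = `|A * u ^+ 2| by rewrite normrM (gtr0_norm u2).
rewrite nM -normrN le_eqVlt.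
apply/orP; left; apply/eqP; congr (`| _ |); field.
by rewrite gt_eqF.
Unshelve. all: by end_near. Qed.

Lemma cvg_pinfty_invsq : (u ^- 2) @[u --> +oo] --> (0 : R).
Proof.
rewrite -(mulr0 0); under eq_fun do rewrite -exprVn expr2.
by apply: cvgM; (apply/gtr0_cvgV0; [exact: nbhs_pinfty_gt|exact: cvg_id]).
Qed.

Lemma cvg_near_one (V : R -> R) (Q : R) :
  u ^+ 2 * (1 - V u) @[u --> +oo] --> Q -> V u @[u --> +oo] --> (1 : R).
Proof.
move=> VQ.
have : 1 - (u ^+ 2 * (1 - V u)) * u ^- 2 @[u --> +oo] --> 1 - Q * 0.
  by apply: cvgB; [exact: cvg_cst|apply: cvgM => //; exact: cvg_pinfty_invsq].
rewrite mulr0 subr0; apply: cvg_trans; apply: near_eq_cvg; near=> u.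
have u0 : 0 < u by near: u; exact: nbhs_pinfty_gt.
by field; rewrite gt_eqF.
Unshelve. all: by end_near. Qed.

(** The combined exponent is [- (u^2 (1 - V) + 2 tau + tau^2 / u^2) / (2 V)], and [V] tends to 1. *)
Lemma cvg_gauss_exponent (V : R -> R) (Q tau : R) :
  u ^+ 2 * (1 - V u) @[u --> +oo] --> Q ->
  u * expR (u ^+ 2 / 2) *
    ((u + tau / u)^-1 * expR (- ((u + tau / u) ^+ 2 / (2 * V u))))
    @[u --> +oo] --> expR (- Q / 2 - tau).
Proof.
move=> VQ.
have cvgV2 := cvg_pinfty_invsq.
have cV1 := cvg_near_one VQ.
have V0 : \forall u \near +oo, 0 < V u.
  exact: (cvgr_gt _ cV1 _ ltr01).
have tau0 : \forall u \near +oo, 0 < 1 + tau * u ^- 2.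
  have : 1 + tau * u ^- 2 @[u --> +oo] --> 1 + tau * 0.
    by apply: cvgD; [exact: cvg_cst|apply: cvgM => //; exact: cvg_cst].
  by rewrite mulr0 addr0 => cv; exact: (cvgr_gt _ cv _ ltr01).
have : (1 + tau * u ^- 2)^-1 *
    expR (- (u ^+ 2 * (1 - V u) + 2 * tau + tau ^+ 2 * u ^- 2) / (2 * V u))
    @[u --> +oo] --> (1 + tau * 0)^-1 *
    expR (- (Q + 2 * tau + tau ^+ 2 * 0) / (2 * 1)).
  apply: cvgM.
    apply: cvgV; first by rewrite mulr0 addr0 oner_neq0.
    by apply: cvgD; [exact: cvg_cst|apply: cvgM => //; exact: cvg_cst].
  apply: (cvg_comp _ expR); last exact: continuous_expR.
  apply: cvgM.
    apply: cvgN; apply: cvgD; first by apply: cvgD => //; exact: cvg_cst.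
    by apply: cvgM => //; exact: cvg_cst.
  apply: cvgV; first by rewrite mulr1.
  by apply: cvgM => //; exact: cvg_cst.
rewrite !mulr0 !addr0 invr1 mul1r mulr1.
rewrite (_ : - (Q + 2 * tau) / 2 = - Q / 2 - tau); last by field.
apply: cvg_trans.
apply: near_eq_cvg; near=> u.
have u0 : 0 < u by near: u; exact: nbhs_pinfty_gt.
have Vu0 : 0 < V u by near: u.
have t0 : 0 < 1 + tau * u ^- 2 by near: u.
have tE : u + tau / u = u * (1 + tau * u ^- 2) by field; rewrite gt_eqF.
rewrite tE; set w := 1 + tau * u ^- 2 in t0 *.
have un : u != 0 by rewrite gt_eqF.
have wn : w != 0 by rewrite gt_eqF.
have Vn : V u != 0 by rewrite gt_eqF.
have -> A B : u * A * ((u * w)^-1 * B) = w^-1 * (A * B) by field; rewrite wn.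
rewrite -expRD /w; congr (_ * expR _); field.
by rewrite Vn un.
Unshelve. all: by end_near. Qed.

End asymptotics.

(** * Tails of linear combinations on the mesh scale *)

Section lincomb_asymptotics.
Context {R : realType} {d : measure_display} {T : measurableType d}.
Variables (P : probability T R) (Z : R -> {RV P >-> R}) (r : R -> R).
Variables (alpha C : R).
Hypothesis Zr : std_stationary_gaussian Z r.
Hypotheses (alpha0 : 0 < alpha) (C0 : 0 < C).
Hypothesis r_o : (fun t : R => r t - (1 - C * `|t| `^ alpha)) =o_ (0 : R)
  (fun t : R => `|t| `^ alpha).
Notation pr A := (fine (P A)).

Definition qform n (a y : 'I_n -> R) : R :=
  \sum_(i < n) \sum_(j < n) a i * a j * (C * `|y j - y i| `^ alpha).

Definition mesh_var n (a y : 'I_n -> R) (u : R) : R :=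
  \sum_(i < n) \sum_(j < n) a i * a j * r ((y j - y i) * mesh alpha u).

Lemma lincomb_var_shift n (a y : 'I_n -> R) (u t : R) :
  lincomb_var r a (fun i => t + y i * mesh alpha u) = mesh_var a y u.
Proof.
apply: eq_bigr => i _; apply: eq_bigr => j _; congr (_ * r _); ring.
Qed.

(** As the squared sum of the coefficients is 1, the 1 in [1 - mesh_var] spreads over the pairs,
    each receiving one [1 - r]. *)
Lemma cvg_mesh_var n (a y : 'I_n -> R) : \sum_(i < n) a i = 1 ->
  u ^+ 2 * (1 - mesh_var a y u) @[u --> +oo] --> qform a y.
Proof.
move=> a1; have -> : (fun u => u ^+ 2 * (1 - mesh_var a y u)) = fun u =>
    \sum_(i < n) \sum_(j < n) a i * a j *
      (u ^+ 2 * (1 - r ((y j - y i) * mesh alpha u))).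
  apply/funext => u; rewrite -[X in X - _](mulr1 1) -{1}a1 -{1}a1 mulr_suml.
  rewrite /mesh_var -sumrB mulr_sumr; apply: eq_bigr => i _.
  by rewrite mulr_sumr -sumrB mulr_sumr; apply: eq_bigr => j _; ring.
apply: cvg_sum_ord => i; apply: cvg_sum_ord => j.
apply: cvgM; first exact: cvg_cst.
exact: (cvg_cov_mesh alpha0 (stationary_cov0 Zr) r_o).
Qed.

(** By stationarity the variance does not depend on [t], so one threshold for [u] serves all [t];
    this matters because the number of sites grows with [u]. The constants come from keeping the
    limit within a factor 2. *)
Lemma lincomb_tail_near n (a y : 'I_n -> R) (tau : R) : \sum_(i < n) a i = 1 ->
  \forall u \near +oo, forall t,
    let p := u * expR (u ^+ 2 / 2) * pr [set w | u + tau / u <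
      lincomb Z a (fun i => t + y i * mesh alpha u) w] in
    expR (- 3) / 12 * expR (- qform a y / 2 - tau) <= p /\
    p <= 2 * expR (- qform a y / 2 - tau).
Proof.
move=> a1; have cq := @cvg_mesh_var n a y a1.
have lim := cvg_gauss_exponent (tau := tau) cq.
set E := expR _ in lim *; have E0 : 0 < E by exact: expR_gt0.
have E2 : E < 2 * E by rewrite ltr_pMl//; lra.
have E1 : E / 2 < E by rewrite ltr_pdivrMr// ltr_pMr//; lra.
have cV : mesh_var a y u @[u --> +oo] --> (1 : R).
  exact: cvg_near_one cq.
have ct : \forall u \near +oo, 1 <= u + tau / u.
  near=> u.
  have u2 : 2 <= u by near: u; exact: nbhs_pinfty_ge.
  have ut : `|tau| <= u by near: u; exact: nbhs_pinfty_ge.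
  have u0 : 0 < u by lra.
  have : - 1 <= tau / u.
    by rewrite ler_pdivlMr// mulN1r; move: ut; rewrite ler_norml => /andP[].
  lra.
have /(_ _) c1 := cvgr_ge _ lim _ E1.
have /(_ _) c2 := cvgr_le _ lim _ E2.
have cV1 : \forall u \near +oo, 2^-1 <= mesh_var a y u.
  by apply: (cvgr_ge _ cV); lra.
have cV4 : \forall u \near +oo, mesh_var a y u <= 4.
  by apply: (cvgr_le _ cV); lra.
near=> u.
move=> t.
have u0 : 0 < u by near: u; exact: nbhs_pinfty_gt.
have K0 : 0 < u * expR (u ^+ 2 / 2) by rewrite mulr_gt0 ?expR_gt0.
have t1 : 1 <= u + tau / u by near: u.
have t0 : 0 < u + tau / u by lra.
have V1 : 2^-1 <= mesh_var a y u by near: u.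
have V4 : mesh_var a y u <= 4 by near: u.
have b1 : E / 2 <= u * expR (u ^+ 2 / 2) * ((u + tau / u)^-1 *
  expR (- ((u + tau / u) ^+ 2 / (2 * mesh_var a y u)))) by near: u.
have b2 : u * expR (u ^+ 2 / 2) * ((u + tau / u)^-1 *
  expR (- ((u + tau / u) ^+ 2 / (2 * mesh_var a y u)))) <= 2 * E by near: u.
have e3 := expR_gt0 (- 3 : R).
split.
  have := @lincomb_tail_ge _ _ _ _ _ _ Zr n a
    (fun i => t + y i * mesh alpha u) (u + tau / u) t1.
  rewrite lincomb_var_shift => /(_ V1 V4) /(ler_wpM2l (ltW K0)).
  apply: le_trans; rewrite mulrCA.
  apply: (@le_trans _ _ (expR (- 3) / 6 * (E / 2))); first by lra.
  by rewrite ler_wpM2l// divr_ge0 ?expR_ge0.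
have V0 : 0 < mesh_var a y u by lra.
have := @lincomb_tail_le _ _ _ _ _ _ Zr n a
  (fun i => t + y i * mesh alpha u) (u + tau / u) _ t0 V0.
by rewrite lincomb_var_shift => /(_ (lexx _) V4) /(ler_wpM2l (ltW K0)) /le_trans; apply.
Unshelve. all: by end_near. Qed.

End lincomb_asymptotics.

(** * Pair and single exceedances *)

Section pair.
Context {R : realType} {d : measure_display} {T : measurableType d}.
Variables (P : probability T R) (Z : R -> {RV P >-> R}) (r : R -> R).
Variables (alpha C h : R).
Hypothesis Zr : std_stationary_gaussian Z r.
Hypotheses (alpha0 : 0 < alpha) (C0 : 0 < C).
Hypothesis r_loc : forall t, 0 < t <= h -> 4 / 5 * (C * t `^ alpha) <= 1 - r t.
Notation pr A := (fine (P A)).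

(** If both values exceed [u], so does their mean, whose variance [(1 + r s) / 2] is at most
    [1 - 2 S / 5]. The estimate is not asymptotic: it holds for every [u] and every lag up to
    [h]. *)
Lemma pair_tail_le (u t s : R) : 0 < u -> 0 < s <= h ->
  u * expR (u ^+ 2 / 2) *
    pr ([set w | u < Z t w] `&` [set w | u < Z (t + s) w]) <=
  expR (- (u ^+ 2 * (C * s `^ alpha) / 5)).
Proof.
move=> u0 sh; have s0 : 0 < s by case/andP: sh.
pose a (i : 'I_2) : R := 2^-1.
pose x (i : 'I_2) : R := if i == 0 :> nat then t else t + s.
have rs := r_loc sh; set S := C * s `^ alpha in rs *.
have S0 : 0 < S by rewrite mulr_gt0// powR_gt0.
have varE : lincomb_var r a x = (1 + r s) / 2.
  rewrite /lincomb_var !big_ord_recl !big_ord0 /a /x /=.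
  have -> : t - (t + s) = - s by ring.
  have -> : t + s - t = s by ring.
  rewrite !subrr (stationary_cov0 Zr) (stationary_covN Zr).
  by field.
(* With [z = 2 S / 5], [1 - z <= 1 / (1 + z)]; the inverse of [v] is affine in [S], so the exponent
   becomes exactly [- u^2 S / 5]. *)
pose v : R := (1 + 2 / 5 * S)^-1.
have v0 : 0 < v by rewrite invr_gt0; lra.
have v1 : v <= 1 by rewrite invf_le1; lra.
have vE : v * (1 + 2 / 5 * S) = 1 by rewrite mulVf// gt_eqF//; lra.
have vv : lincomb_var r a x <= v by rewrite varE; nra.
have v4 : v <= 4 by lra.
have := lincomb_tail_le Zr u0 v0 vv v4.
have sub : [set w | u < Z t w] `&` [set w | u < Z (t + s) w] `<=`
    [set w | u < lincomb Z a x w].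
  by move=> w /= [h1 h2]; rewrite /lincomb !big_ord_recl big_ord0 /a /x /=; lra.
have le1 : pr ([set w | u < Z t w] `&` [set w | u < Z (t + s) w]) <=
    pr [set w | u < lincomb Z a x w].
  apply: pr_le => //.
    by apply: measurableI; apply: measurable_gt; exact: measurable_funPT.
  by apply: measurable_gt; exact: measurable_lincomb.
move=> /(le_trans le1) h1.
have K0 : 0 < u * expR (u ^+ 2 / 2) by rewrite mulr_gt0 ?expR_gt0.
apply: le_trans (ler_wpM2l (ltW K0) h1) _.
have -> : u * expR (u ^+ 2 / 2) * (u^-1 * expR (- (u ^+ 2 / (2 * v)))) =
    expR (u ^+ 2 / 2) * expR (- (u ^+ 2 / (2 * v))).
  by field; rewrite gt_eqF.
rewrite -expRD ler_expR le_eqVlt; apply/orP; left; apply/eqP.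
rewrite /v; field.
by rewrite gt_eqF//; lra.
Qed.

Lemma mesh_sqr (u k : R) : 0 < u -> 0 <= k ->
  u ^+ 2 * (C * (k * mesh alpha u) `^ alpha) = C * k `^ alpha.
Proof.
move=> u0 k0; rewrite powRM//; last exact: ltW (mesh_gt0 _ u0).
by rewrite mesh_powR//; field; rewrite gt_eqF.
Qed.

Lemma mesh_pair_tail_le (u a : R) (i j : nat) : 0 < u -> 0 < a -> (i < j)%N ->
  j%:R * (a * mesh alpha u) <= h ->
  u * expR (u ^+ 2 / 2) * pr ([set w | u < Z (i%:R * (a * mesh alpha u)) w] `&`
    [set w | u < Z (j%:R * (a * mesh alpha u)) w]) <=
  expR (- (C * (a * (j - i)%:R) `^ alpha / 5)).
Proof.
move=> u0 a0 ij jh; have am0 : 0 < a * mesh alpha u.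
  by rewrite mulr_gt0// mesh_gt0.
have -> : j%:R * (a * mesh alpha u) =
    i%:R * (a * mesh alpha u) + a * (j - i)%:R * mesh alpha u.
  by rewrite natrB ?(ltnW ij)//; ring.
rewrite -(mesh_sqr u0) ?mulr_ge0 ?(ltW a0)//.
apply: pair_tail_le => //; rewrite -mulrA mulrCA pmulr_rgt0 ?ltr0n ?subn_gt0// am0 /=.
by apply: le_trans jh; rewrite ler_pM2r// ler_nat leq_subr.
Qed.

End pair.

Section single.
Context {R : realType} {d : measure_display} {T : measurableType d}.
Variables (P : probability T R) (Z : R -> {RV P >-> R}) (r : R -> R).
Variables (alpha C : R).
Hypothesis Zr : std_stationary_gaussian Z r.
Hypotheses (alpha0 : 0 < alpha) (C0 : 0 < C).
Hypothesis r_o : (fun t : R => r t - (1 - C * `|t| `^ alpha)) =o_ (0 : R)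
  (fun t : R => `|t| `^ alpha).
Notation pr A := (fine (P A)).

Lemma single_tail_ge : \forall u \near +oo, forall t,
  expR (- 3) / 12 <= u * expR (u ^+ 2 / 2) * pr [set w | u < Z t w].
Proof.
pose a (i : 'I_1) : R := 1; pose y (i : 'I_1) : R := 0.
have a1 : \sum_(i < 1) a i = 1 by rewrite big_ord1.
have q0 : qform alpha C a y = 0.
  by rewrite /qform !big_ord1 /a /y subrr normr0 powR0 ?gt_eqF// !mulr0.
have := lincomb_tail_near Zr alpha0 r_o y 0 a1.
apply: filterS => u H t; have [+ _] := H t.
rewrite q0 !(mul0r, oppr0, addr0) expR0 mulr1.
congr (_ <= _ * fine (P _)); apply/seteqP; split => w /=;
  by rewrite /lincomb big_ord1 /a /y mul1r mul0r addr0.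
Qed.

End single.

(** * Extracting a process from uniqueness of the constant *)

Lemma pickands_constant_elim (R : realType) (alpha H : R) (G : Prop) :
  0 < alpha -> is_pickands_constant alpha H ->
  (forall (d : measure_display) (T : measurableType d) (P : probability T R)
     (Z : R -> {RV P >-> R}) (r : R -> R) (C h : R),
     0 < C -> 0 < h -> std_stationary_gaussian Z r ->
     (fun t : R => r t - (1 - C * `|t| `^ alpha)) =o_ (0 : R)
       (fun t : R => `|t| `^ alpha) ->
     (forall t, 0 < t <= h -> 4 / 5 * (C * t `^ alpha) <= 1 - r t) -> G) -> G.
Proof.
move=> alpha0 [_ uniqH] imp; apply: contrapT => nG.
(* If [G] fails, no process satisfies the hypotheses, so [H + 1] qualifies vacuously, against
   uniqueness. *)
have : H = H + 1.
  apply: uniqH => d T P Z r C h C0 h0 Zr [r_o _].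
  exfalso; apply: nG.
  (* The horizon is replaced by one on which the local bound holds throughout. *)
  have [h' h'0 loc] := cov_local_bound C0 r_o.
  exact: (imp _ _ _ _ _ _ _ C0 h'0 Zr r_o loc).
by move/eqP; rewrite -subr_eq0 opprD addrA subrr sub0r oppr_eq0 oner_eq0.
Qed.

(** * Exponents bounded away from zero *)

Lemma sum_inv_sqr_le {R : realType} n : \sum_(i < n) (i.+1%:R ^- 2 : R) <= 2.
Proof.
case: n => [|n]; first by rewrite big_ord0.
(* The strengthened bound telescopes. *)
suff : \sum_(i < n.+1) (i.+1%:R ^- 2 : R) <= 2 - n.+1%:R^-1.
  by move=> /le_trans; apply; rewrite gerBl invr_ge0.
elim: n => [|n IHn]; first by rewrite big_ord1 expr1n invr1; lra.
rewrite big_ord_recr /=.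
have n0 : 0 < n.+1%:R :> R by rewrite ltr0n.
have : n.+2%:R ^- 2 <= n.+1%:R^-1 - n.+2%:R^-1 :> R.
  rewrite -[n.+2%:R]natr1; set x := n.+1%:R in n0 *.
  have -> : x^-1 - (x + 1)^-1 = (x * (x + 1))^-1 by field; rewrite !gt_eqF//; lra.
  rewrite lef_pV2 ?posrE ?exprn_gt0 ?mulr_gt0//; nra.
by move=> h; apply: le_trans (lerD IHn h) _; rewrite addrA subrK.
Qed.

(** Power [n] of [expR (x / n) >= x / n], inverted: it trades exponential decay for polynomial decay
    of any chosen order. *)
Lemma expRN_le_inv_pow {R : realType} (x : R) n : 0 < x ->
  expR (- x) <= (n%:R / x) ^+ n.
Proof.
case: n => [|n] x0; first by rewrite expr0 -expR0 ler_expR lerNl oppr0 ltW.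
have n0 : 0 < n.+1%:R :> R by rewrite ltr0n.
have -> : x = n.+1%:R * (x / n.+1%:R) by rewrite mulrC divfK ?gt_eqF.
rewrite expRN expRM_natl -exprVn; apply: lerXn2r.
- by rewrite nnegrE invr_ge0 expR_ge0.
- by rewrite nnegrE divr_ge0// ltW// mulr_gt0// divr_gt0.
- have y0 : 0 < x / n.+1%:R by rewrite divr_gt0.
  rewrite invfM mulVKf ?gt_eqF// lef_pV2 ?posrE ?expR_gt0//.
  by apply: le_trans (expR_ge1Dx _); rewrite lerDr.
Qed.

(** Plain exceedances suffice here: on a coarse enough mesh the pair terms sum to at most half of
    the single term. *)
Lemma pickands_large_alpha (R : realType) (alpha1 : R) : 0 < alpha1 ->
  exists2 c : R, 0 < c & forall alpha H : R, alpha1 <= alpha <= 2 ->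
    is_pickands_constant alpha H -> c <= H.
Proof.
move=> alpha10.
pose p : R := expR (- 3) / 12.
have p0 : 0 < p by rewrite divr_gt0 ?expR_gt0.
have p1 : p <= 1.
  have : expR (- 3) <= 1 :> R by rewrite -[leRHS]expR0 ler_expR; lra.
  rewrite /p; lra.
(* With [n * alpha1 >= 2], power [n] of [k^(- alpha)] is at most [k^-2]. *)
pose n := (Num.truncn (2 / alpha1)).+1.
have n0 : 0 < n%:R :> R by rewrite ltr0n.
have n2 : 2 <= n%:R * alpha1.
  by rewrite -ler_pdivrMr// ltW// truncnS_gt.
(* Chosen so that [n / (B * k^alpha / 5) = p / 4 / k^alpha]; summing [k^-2] then turns [p / 4] into
   [p / 2]. *)
pose B : R := 20 * n%:R / p.
have B0 : 0 < B by rewrite !mulr_gt0 ?invr_gt0.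
have B1 : 1 <= B.
  have n1 : 1 <= n%:R :> R by rewrite ler1n.
  by rewrite ler_pdivlMr// mul1r; lra.
have Bp : 0 < B `^ alpha1^-1 by rewrite powR_gt0.
exists (p / B `^ alpha1^-1); first by rewrite divr_gt0.
move=> alpha H /andP[a1 a2] HH.
have alpha0 : 0 < alpha by exact: lt_le_trans a1.
apply: (pickands_constant_elim alpha0 HH) => d T P Z r C h C0 h0 Zr r_o loc.
(* The spacing solves [C * a^alpha = B]. *)
pose a := (B / C) `^ alpha^-1.
have a0 : 0 < a by apply: powR_gt0; rewrite divr_gt0.
have aC : a * C `^ alpha^-1 = B `^ alpha^-1.
  rewrite /a -powRM ?(ltW C0) ?(ltW (divr_gt0 B0 C0))//.
  by rewrite divfK// gt_eqF.
have aCk k : C * (a * k%:R) `^ alpha = B * k%:R `^ alpha.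
  rewrite powRM ?(ltW a0)// /a -powRrM mulVf ?gt_eqF// powRr1; last exact: ltW (divr_gt0 B0 C0).
  by field; rewrite gt_eqF.
have key : p <= H * (a * C `^ alpha^-1).
  apply: (pickands_lower_bound Zr alpha0 C0 h0 r_o loc HH.1 a0 p0
    (b := fun k => expR (- (C * (a * k%:R) `^ alpha / 5)))
    (A := fun u j => [set w | u < Z (j%:R * (a * mesh alpha u)) w])).
  - by move=> u j; apply: measurable_gt; exact: measurable_funPT.
  - by move=> u j w.
  - by apply: filterS (single_tail_ge Zr alpha0 r_o) => u su j; exact: su.
  - near=> u.
    have u0 : 0 < u by near: u; exact: nbhs_pinfty_gt.
    by move=> i j ij jh; exact: (mesh_pair_tail_le Zr alpha0 C0 loc).
  - move=> N; apply: (@le_trans _ _ (\sum_(i < N) p / 4 * (i.+1%:R ^- 2))); last first.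
      by rewrite -mulr_sumr; have := @sum_inv_sqr_le R N; nra.
    apply: ler_sum => i _; rewrite aCk.
    have k1 : 1 <= i.+1%:R :> R by rewrite ler1n.
    set k : R := i.+1%:R in k1 *.
    have k0 : 0 < k by lra.
    have ka0 : 0 < k `^ alpha by rewrite powR_gt0.
    apply: le_trans (@expRN_le_inv_pow R _ n _) _.
      by rewrite divr_gt0// mulr_gt0.
    have -> : n%:R / (B * k `^ alpha / 5) = p / 4 / k `^ alpha.
      by rewrite /B; field; rewrite !gt_eqF.
    rewrite expr_div_n; apply: ler_pM.
    - by rewrite exprn_ge0// divr_ge0 ?ltW.
    - by rewrite invr_ge0 exprn_ge0// ltW.
    - by rewrite /n exprS ler_piMr ?divr_ge0 ?(ltW p0)// exprn_ile1 ?divr_ge0 ?(ltW p0)//; lra.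
    - rewrite lef_pV2 ?posrE ?exprn_gt0// -!powR_mulrn ?(ltW ka0) ?(ltW k0)//.
      rewrite -powRrM ler_powR// mulrC; apply: le_trans n2 _.
      by rewrite ler_pM2l.
have H0 : 0 < H.
  have aC0 : 0 < a * C `^ alpha^-1 by rewrite mulr_gt0// powR_gt0.
  by rewrite -(pmulr_lgt0 _ aC0); exact: lt_le_trans key.
rewrite ler_pdivrMr//; apply: le_trans key _; rewrite aC ler_pM2l//.
rewrite ler_powR// lef_pV2 ?posrE//.
Unshelve. all: by end_near. Qed.

(** * Quadratic forms involving a local average *)

Section averaged_functional.
Context {R : realType}.
Variables (alpha C X : R) (m : nat).
Hypotheses (alpha0 : 0 < alpha) (C0 : 0 < C) (X0 : 0 < X) (m0 : (0 < m)%N).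

(** Index 0 is the site, index 1 a second site, and the other [m] indices are the averaged points
    sharing the weight [c2]. *)
Definition avg_coef (c0 c1 c2 : R) (i : 'I_m.+2) : R :=
  match val i with 0%N => c0 | 1%N => c1 | _ => c2 / m%:R end.

(** The last branch sees indices from 2 on, so [q] runs from 1 to [m] and no averaged point
    coincides with the site. *)
Definition avg_off (k : R) (i : 'I_m.+2) : R :=
  match val i with 0%N => 0 | 1%N => k | q.+1 => - (q%:R * X) end.

Let mR0 : 0 < m%:R :> R. Proof. by rewrite ltr0n. Qed.

Lemma sum_avg_coef c0 c1 c2 : \sum_(i < m.+2) avg_coef c0 c1 c2 i = c0 + c1 + c2.
Proof.
rewrite !big_ord_recl /= /avg_coef /= sumr_const card_ord addrA; congr (_ + _).
by rewrite -[_ *+ m]mulr_natr divfK// gt_eqF.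
Qed.

Lemma lincomb_avg {d : measure_display} {T : measurableType d}
    (P : probability T R) (Z : R -> {RV P >-> R}) c0 c1 c2 k l t w :
  lincomb Z (avg_coef c0 c1 c2) (fun i => t + avg_off k i * l) w =
  c0 * Z t w + c1 * Z (t + k * l) w +
  c2 * (m%:R^-1 * \sum_(q < m) Z (t - q.+1%:R * X * l) w).
Proof.
rewrite /lincomb !big_ord_recl /= /avg_coef /avg_off /= mul0r addr0 addrA.
congr (_ + _); rewrite !mulr_sumr; apply: eq_bigr => i _.
by rewrite /= mulNr mulrA.
Qed.

(** [avg_near], [avg_far] and [avg_self] are the limits of [u^2] times 1 minus the covariance of the
    average with the site, with the second site and with itself. *)
Definition avg_near : R := m%:R^-1 * \sum_(q < m) C * (q.+1%:R * X) `^ alpha.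
Definition avg_far (k : R) : R :=
  m%:R^-1 * \sum_(q < m) C * (k + q.+1%:R * X) `^ alpha.
Definition avg_self : R :=
  m%:R^-1 ^+ 2 * \sum_(q < m) \sum_(p < m) C * `|p.+1%:R * X - q.+1%:R * X| `^ alpha.

Lemma qform_avg c0 c1 c2 k : 0 <= k ->
  qform alpha C (avg_coef c0 c1 c2) (avg_off k) =
  2 * c0 * c1 * (C * k `^ alpha) + 2 * c0 * c2 * avg_near +
  2 * c1 * c2 * avg_far k + c2 ^+ 2 * avg_self.
Proof.
move=> k0; rewrite /qform.
have nz (q : nat) : 0 <= q%:R * X by rewrite mulr_ge0// ltW.
under eq_bigr do rewrite !big_ord_recl.
rewrite !big_ord_recl /= /avg_coef /avg_off /=.
rewrite !subrr normr0 powR0 ?gt_eqF// !mulr0 !add0r.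
have bE (i : 'I_m) : (0 + bump 0 i)%N = i.+1 by [].
transitivity (c0 * c1 * (C * k `^ alpha) + c0 * c2 * avg_near +
  (c0 * c1 * (C * k `^ alpha) + c1 * c2 * avg_far k +
   (c0 * c2 * avg_near + (c1 * c2 * avg_far k + c2 ^+ 2 * avg_self))));
  last by ring.
congr (_ + _ + (_ + _ + _)).
- by rewrite subr0 ger0_norm.
- rewrite /avg_near !mulr_sumr; apply: eq_bigr => i _.
  by rewrite bE subr0 normrN ger0_norm//; field; rewrite gt_eqF.
- by rewrite normrN ger0_norm// (mulrC c1).
- rewrite /avg_far !mulr_sumr; apply: eq_bigr => i _.
  rewrite bE -opprD normrN ger0_norm ?addr_ge0// (addrC k).
  by field; rewrite gt_eqF.
rewrite !big_split /=; congr (_ + (_ + _)).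
- rewrite /avg_near !mulr_sumr; apply: eq_bigr => i _.
  by rewrite bE sub0r opprK ger0_norm//; field; rewrite gt_eqF.
- rewrite /avg_far !mulr_sumr; apply: eq_bigr => i _.
  by rewrite bE opprK ger0_norm ?addr_ge0//; field; rewrite gt_eqF.
rewrite /avg_self !mulr_sumr; apply: eq_bigr => i _.
rewrite !mulr_sumr; apply: eq_bigr => j _.
rewrite !bE -opprB opprK normrN [X in `|X|]addrC -normrN opprB.
by field; rewrite gt_eqF.
Qed.

End averaged_functional.

Section averaged_bounds.
Context {R : realType}.
Variables (alpha C X : R) (m : nat).
Hypotheses (alpha0 : 0 < alpha) (C0 : 0 < C) (X0 : 0 < X) (m0 : (0 < m)%N).

Let mR0 : 0 < m%:R :> R. Proof. by rewrite ltr0n. Qed.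
Let mR1 : 1 <= m%:R :> R. Proof. by rewrite ler1n. Qed.

(** Close to 1 once [alpha] is small compared with [1 / ln (2 m)]: distances within a ratio [2 m]
    then have nearly equal powers [alpha], so [avg_near] and [avg_self] are close to [S]. *)
Let D : R := (2 * m%:R) `^ alpha.
Let S : R := C * X `^ alpha.
Let S0 : 0 < S. Proof. by rewrite mulr_gt0// powR_gt0. Qed.

Let pow_le (x y : R) : 0 <= x -> x <= y -> C * x `^ alpha <= C * y `^ alpha.
Proof.
move=> x0 xy; rewrite ler_pM2l//.
by apply: ge0_ler_powR; rewrite ?nnegrE ?(ltW alpha0)//; exact: le_trans xy.
Qed.

Let DS (y : R) : 0 <= y -> C * (2 * m%:R * y) `^ alpha = D * (C * y `^ alpha).
Proof. by move=> y0; rewrite powRM ?mulr_ge0// mulrCA. Qed.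

Let avg_ge (f : 'I_m -> R) l : (forall q, l <= f q) -> l <= m%:R^-1 * \sum_q f q.
Proof.
move=> lf; rewrite ler_pdivlMl// mulr_natl -[X in _ *+ X]card_ord -sumr_const.
by apply: ler_sum => q _.
Qed.

Let avg_le (f : 'I_m -> R) l : (forall q, f q <= l) -> m%:R^-1 * \sum_q f q <= l.
Proof.
move=> lf; rewrite ler_pdivrMl// mulr_natl -[X in _ *+ X]card_ord -sumr_const.
by apply: ler_sum => q _.
Qed.

Let qm (q : 'I_m) : q.+1%:R <= m%:R :> R. Proof. by rewrite ler_nat. Qed.
Let q1 (q : 'I_m) : 1 <= q.+1%:R :> R. Proof. by rewrite ler1n. Qed.

Lemma avg_near_ge : S <= avg_near alpha C X m.
Proof.
apply: avg_ge => q; apply: pow_le; first exact: ltW.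
by rewrite ler_peMl ?(ltW X0).
Qed.

Lemma avg_near_le : avg_near alpha C X m <= D * S.
Proof.
apply: avg_le => q; rewrite -DS ?(ltW X0)//; apply: pow_le.
  by rewrite mulr_ge0 ?(ltW X0).
by rewrite ler_pM2r//; apply: le_trans (qm q) _; rewrite ler_peMl ?(ltW mR0)// ler1n.
Qed.

Lemma avg_far_le (k y : R) : 0 <= k -> k <= y -> X <= y ->
  avg_far alpha C X m k <= D * (C * y `^ alpha).
Proof.
move=> k0 ky Xy; have y0 : 0 <= y by exact: le_trans ky.
apply: avg_le => q; rewrite -DS//; apply: pow_le.
  by rewrite addr_ge0// mulr_ge0 ?(ltW X0).
have h1 : q.+1%:R * X <= m%:R * y by apply: ler_pM => //; exact: ltW.
have h2 : y <= m%:R * y by rewrite ler_peMl.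
lra.
Qed.

Lemma avg_self_le : avg_self alpha C X m <= D * S.
Proof.
rewrite /avg_self expr2 -mulrA; apply: (@le_trans _ _ (m%:R^-1 * \sum_(q < m) D * S)).
  rewrite ler_pM2l ?invr_gt0// mulr_sumr; apply: ler_sum => q _.
  apply: avg_le => p; rewrite -DS ?(ltW X0)//; apply: pow_le => //.
  have h1 : p.+1%:R * X <= m%:R * X by rewrite ler_pM2r.
  have h2 : q.+1%:R * X <= m%:R * X by rewrite ler_pM2r.
  have h3 : 0 <= p.+1%:R * X by rewrite mulr_ge0 ?(ltW X0).
  have h4 : 0 <= q.+1%:R * X by rewrite mulr_ge0 ?(ltW X0).
  by rewrite ler_norml; lra.
exact: avg_le.
Qed.

(** Only the [m] diagonal terms among [m^2] vanish; all other pairs are at distance at least [X]. *)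
Lemma avg_self_ge : (1 - m%:R^-1) * S <= avg_self alpha C X m.
Proof.
have dist (p q : nat) : p != q -> 1 <= `|p%:R - q%:R| :> R.
  wlog pq : p q / (p < q)%N => [H|_].
    case: (ltngtP p q) => // pq _; first by apply: H => //; rewrite ltn_eqF.
    by rewrite distrC; apply: H => //; rewrite ltn_eqF.
  have h : p%:R + 1 <= q%:R :> R by rewrite natr1 ler_nat.
  by rewrite distrC ger0_norm; lra.
rewrite /avg_self expr2 -mulrA mulr_sumr; apply: avg_ge => q.
rewrite (bigD1 q)//= subrr normr0 powR0 ?gt_eqF// mulr0 add0r.
apply: (@le_trans _ _ (m%:R^-1 * \sum_(p < m | p != q) S)).
  rewrite sumr_const cardC1 card_ord -[S *+ _]mulr_natr.
  have -> : m.-1%:R = m%:R - 1 :> R by rewrite -{2}(prednK m0) -natr1 addrK.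
  by rewrite le_eqVlt; apply/orP; left; apply/eqP; field; rewrite gt_eqF.
rewrite ler_pM2l ?invr_gt0//; apply: ler_sum => p pq; apply: pow_le; first exact: ltW.
rewrite -mulrBl normrM (gtr0_norm X0) ler_peMl ?(ltW X0)//.
by apply: dist; rewrite eqSS.
Qed.

End averaged_bounds.

(** * Truncated exceedance events *)

Section truncation.
Context {R : realType} {d : measure_display} {T : measurableType d}.
Variables (P : probability T R) (Z : R -> {RV P >-> R}) (r : R -> R).
Variables (alpha C X : R) (m : nat).
Hypothesis Zr : std_stationary_gaussian Z r.
Hypotheses (alpha0 : 0 < alpha) (m0 : (0 < m)%N).
Hypothesis r_o : (fun t : R => r t - (1 - C * `|t| `^ alpha)) =o_ (0 : R)
  (fun t : R => `|t| `^ alpha).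
Notation pr A := (fine (P A)).

Definition avg_tail (c0 c1 c2 k tau : R) : R :=
  expR (- qform alpha C (@avg_coef R m c0 c1 c2) (avg_off X k) / 2 - tau).

Definition local_avg (u t : R) (w : T) : R :=
  m%:R^-1 * \sum_(q < m) Z (t - q.+1%:R * X * mesh alpha u) w.

Definition truncated (M u t : R) : set T :=
  [set w | u < Z t w] `&` [set w | local_avg u t w <= u - M / u].

Lemma measurable_local_avg u t : measurable_fun setT (local_avg u t).
Proof.
apply: measurable_funM => //; apply: measurable_sum => q; exact: measurable_funPT.
Qed.

Lemma measurable_truncated M u t : measurable (truncated M u t).
Proof.
apply: measurableI; first by apply: measurable_gt; exact: measurable_funPT.
rewrite (_ : [set w | _] = ~` [set w | u - M / u < local_avg u t w]).
  by apply: measurableC; apply: measurable_gt; exact: measurable_local_avg.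
by apply/seteqP; split => w /=; [move=> h; apply/negP; rewrite -leNgt|
  move=> /negP; rewrite -leNgt].
Qed.

Let avg_event c0 c1 c2 k tau u t : set T := [set w | u + tau / u <
  c0 * Z t w + c1 * Z (t + k * mesh alpha u) w + c2 * local_avg u t w].

Let avg_event_near c0 c1 c2 k tau : c0 + c1 + c2 = 1 ->
  \forall u \near +oo, forall t,
    expR (- 3) / 12 * avg_tail c0 c1 c2 k tau <=
      u * expR (u ^+ 2 / 2) * pr (avg_event c0 c1 c2 k tau u t) /\
    u * expR (u ^+ 2 / 2) * pr (avg_event c0 c1 c2 k tau u t) <=
      2 * avg_tail c0 c1 c2 k tau.
Proof.
move=> c1E; have := lincomb_tail_near Zr alpha0 r_o (avg_off X k) tau
  (etrans (sum_avg_coef m0 c0 c1 c2) c1E).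
apply: filterS => u H t; have := H t.
rewrite (_ : [set w | _] = avg_event c0 c1 c2 k tau u t)//.
by apply/seteqP; split => w /=; rewrite /avg_event /= lincomb_avg.
Qed.

Let measurable_avg_event c0 c1 c2 k tau u t :
  measurable (avg_event c0 c1 c2 k tau u t).
Proof.
apply: measurable_gt; apply: measurable_funD.
  by apply: measurable_funD; apply: measurable_funM => //; exact: measurable_funPT.
by apply: measurable_funM => //; exact: measurable_local_avg.
Qed.

(** Let [Y > u + tau / u] while truncation fails. If [Z t <= u], multiply by [1 + ka1] and subtract
    [ka1] times this inequality; if the average is above [u - M / u], mix it in with weight [ka2].
    Both results are tail events with coefficients summing to 1, and [ka1], [ka2] remain free for
    optimisation. *)
Lemma truncated_single_ge (w tau M ka1 ka2 : R) : 0 <= ka1 -> 0 <= ka2 < 1 ->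
  \forall u \near +oo, forall t,
    expR (- 3) / 12 * avg_tail (1 + w) 0 (- w) 0 tau -
    2 * avg_tail ((1 + ka1) * (1 + w) - ka1) 0 (- ((1 + ka1) * w)) 0
      ((1 + ka1) * tau) -
    2 * avg_tail ((1 - ka2) * (1 + w)) 0 (ka2 - (1 - ka2) * w) 0
      ((1 - ka2) * tau - ka2 * M) <=
    u * expR (u ^+ 2 / 2) * pr (truncated M u t).
Proof.
move=> ka10 /andP[ka20 ka21].
have nY := @avg_event_near (1 + w) 0 (- w) 0 tau ltac:(ring).
have n1 := @avg_event_near ((1 + ka1) * (1 + w) - ka1) 0 (- ((1 + ka1) * w)) 0
  ((1 + ka1) * tau) ltac:(ring).
have n2 := @avg_event_near ((1 - ka2) * (1 + w)) 0 (ka2 - (1 - ka2) * w) 0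
  ((1 - ka2) * tau - ka2 * M) ltac:(ring).
have npos : \forall u \near +oo, 0 < (u : R) by exact: nbhs_pinfty_gt.
apply: filterS (filterI npos (filterI nY (filterI n1 n2))).
move=> u [u0 [hY [h1 h2]]] t.
move: hY h1 h2 => /(_ t)[hY _] /(_ t)[_ h1] /(_ t)[_ h2].
have K0 : 0 < u * expR (u ^+ 2 / 2) by rewrite mulr_gt0 ?expR_gt0.
set B0 := avg_event (1 + w) 0 (- w) 0 tau u t in hY.
set B1 := avg_event _ _ _ _ _ _ _ in h1 *.
set B2 := avg_event _ _ _ _ _ _ _ in h2 *.
have sub : B0 `<=` truncated M u t `|` (B1 `|` B2).
  move=> x; rewrite /B0 /B1 /B2 /avg_event /truncated /= !mul0r !addr0.
  rewrite -[(1 + ka1) * tau / u]mulrA [X in u + X < (1 - ka2) * _ * _ + _]mulrBl.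
  rewrite -[(1 - ka2) * tau / u]mulrA -[ka2 * M / u]mulrA.
  set z := Z t x; set l := local_avg u t x.
  set v := tau / u; set n := M / u => hx.
  have [zu|zu] := leP z u.
    right; left.
    have e1 : (1 + ka1) * (u + v) < (1 + ka1) * ((1 + w) * z + - w * l).
      by rewrite ltr_pM2l//; lra.
    have e2 : ka1 * z <= ka1 * u by exact: ler_wpM2l.
    lra.
  have [lu|lu] := leP l (u - n); first by left.
  right; right.
  have e1 : (1 - ka2) * (u + v) < (1 - ka2) * ((1 + w) * z + - w * l).
    by rewrite ltr_pM2l//; lra.
  have e2 : ka2 * (u - n) <= ka2 * l by apply: ler_wpM2l => //; exact: ltW.
  lra.
have mA := measurable_truncated M u t.
have mB1 : measurable B1 by exact: measurable_avg_event.
have mB2 : measurable B2 by exact: measurable_avg_event.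
have mB0 : measurable B0 by exact: measurable_avg_event.
have mB12 : measurable (B1 `|` B2) by exact: measurableU.
have le0 := pr_le P mB0 (measurableU _ _ mA mB12) sub.
have le1 := prU_le P mA mB12.
have le2 := prU_le P mB1 mB2.
have : pr B0 <= pr (truncated M u t) + (pr B1 + pr B2) by lra.
move=> /(ler_wpM2l (ltW K0)); lra.
Qed.

(** The defining inequalities are added with weights [1 + mu - la], [la] and [mu]; the only average
    used is the one attached to [t]. *)
Lemma truncated_pair_le (la mu M k : R) : 0 < la -> 0 <= mu -> la <= 1 + mu ->
  \forall u \near +oo, forall t,
    u * expR (u ^+ 2 / 2) *
      pr (truncated M u t `&` truncated M u (t + k * mesh alpha u)) <=
    2 * avg_tail (1 + mu - la) la (- mu) k (mu * M).
Proof.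
move=> la0 mu0 la1.
have n1 := @avg_event_near (1 + mu - la) la (- mu) k (mu * M) ltac:(ring).
have npos : \forall u \near +oo, 0 < (u : R) by exact: nbhs_pinfty_gt.
apply: filterS (filterI npos n1) => u [u0 h1] t.
have K0 : 0 < u * expR (u ^+ 2 / 2) by rewrite mulr_gt0 ?expR_gt0.
have [_] := h1 t; apply: le_trans.
rewrite ler_pM2l//; apply: pr_le.
- by apply: measurableI; exact: measurable_truncated.
- exact: measurable_avg_event.
move=> x; rewrite /truncated /avg_event /= => -[[x1 x2] [x3 _]].
have a1 : (1 + mu - la) * u <= (1 + mu - la) * Z t x.
  by apply: ler_wpM2l; [lra|exact: ltW].
have a2 : la * u < la * Z (t + k * mesh alpha u) x by rewrite ltr_pM2l.
have a3 : mu * local_avg u t x <= mu * (u - M / u) by apply: ler_wpM2l.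
rewrite -[mu * M / u]mulrA; set Mu := M / u in a3 *; lra.
Qed.

End truncation.

(** * Elementary inequalities for sums, [ln] and [expR] *)

Lemma harmonic_le {R : realType} n :
  \sum_(i < n.+1) (i.+1%:R^-1 : R) <= 1 + ln n.+1%:R.
Proof.
elim: n => [|n IHn]; first by rewrite big_ord1 ln1 invr1 addr0.
rewrite big_ord_recr /=; apply: le_trans (lerD IHn (lexx _)) _.
rewrite -addrA lerD2l; set x : R := n.+1%:R.
have x0 : 0 < x by rewrite ltr0n.
have y0 : 0 < n.+2%:R :> R by rewrite ltr0n.
have -> : x = n.+2%:R * (1 + - n.+2%:R^-1).
  by rewrite mulrDr mulr1 mulrN divff ?gt_eqF// -natr1 addrK.
have y1 : n.+2%:R^-1 < 1 :> R by rewrite invf_lt1// ltr1n.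
rewrite lnM ?posrE//; last by rewrite subr_gt0.
rewrite -addrA gerDl -lerBrDr sub0r.
by apply: le_ln1Dx; rewrite ltrN2.
Qed.

Lemma sum_truncate_le {R : realType} (f : nat -> R) K n : (forall i, 0 <= f i) ->
  \sum_(i < n) (if (i < K)%N then f i else 0) <= \sum_(i < K) f i.
Proof.
move=> f0; pose g i := if (i < K)%N then f i else 0.
have g0 i : 0 <= g i by rewrite /g; case: ifP.
apply: (@le_trans _ _ (\sum_(i < n + K) g i)).
  by rewrite big_split_ord /= lerDl sumr_ge0.
rewrite addnC big_split_ord /= [X in _ + X]big1 ?addr0.
  by apply: ler_sum => i _; rewrite /g ltn_ord.
by move=> i _; rewrite /g ltnNge leq_addr.
Qed.

(** From [ln (c x) <= c x - 1], the hypothesis being a lower bound for [ln c]. *)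
Lemma ln_le_line {R : realType} (c b x : R) : expR (- (1 + b)) <= c -> 0 < x ->
  ln x <= c * x + b.
Proof.
move=> cb x0; have c0 : 0 < c by apply: lt_le_trans cb; exact: expR_gt0.
have h : - (1 + b) <= ln c by rewrite -[leLHS]expRK ler_ln ?posrE ?expR_gt0.
have : ln (c * x) <= c * x - 1.
  rewrite -[leRHS]expRK ler_ln ?posrE ?mulr_gt0 ?expR_gt0//.
  by apply: le_trans (expR_ge1Dx _); rewrite addrC subrK.
by rewrite lnM ?posrE//; lra.
Qed.

Lemma expR_ge_pow {R : realType} (x : R) n : 0 <= 1 + x / n.+1%:R ->
  (1 + x / n.+1%:R) ^+ n.+1 <= expR x.
Proof.
move=> h; have {2}-> : x = n.+1%:R * (x / n.+1%:R).
  by rewrite mulrC divfK// pnatr_eq0.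
rewrite [leRHS]expRM_natl.
by apply: lerXn2r; rewrite ?nnegrE ?expR_ge0 ?expR_ge1Dx.
Qed.

Section ln_bounds.
Context {R : realType}.
Variable x : R.
Hypothesis x0 : 0 < x.

(** Slopes and intercepts of the three lines are fitted to the exponents in [pair_bound] (the first
    two) and [far_bound] (the third). This one amounts to [expR (3 / 5) <= 15 / 8]. *)
Lemma ln_le_line1 : ln x <= 15 / 8 * x - 8 / 5.
Proof.
apply: ln_le_line => //.
have h : 8 / 15 <= expR (- (3 / 5)) :> R.
  apply: le_trans (@expR_ge_pow _ _ 7 _); last lra.
  have -> : 1 + - (3 / 5) / 8 = 37 / 40 :> R by lra.
  have -> (y : R) : y ^+ 8 = y * y * (y * y) * (y * y * (y * y)) by ring.
  lra.
rewrite (_ : - (1 + - (8 / 5)) = - - (3 / 5) :> R); last lra.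
rewrite expRN invf_ple ?posrE ?expR_gt0//; lra.
Qed.

Lemma ln_le_line2 : ln x <= 4 / 11 * x + 1 / 20.
Proof.
apply: ln_le_line => //.
have h : 11 / 4 <= expR (21 / 20) :> R.
  apply: le_trans (@expR_ge_pow _ _ 15 _); last lra.
  have -> : 1 + 21 / 20 / 16 = 341 / 320 :> R by lra.
  have -> (y : R) : y ^+ 16 = y * y * (y * y) * (y * y * (y * y)) *
    (y * y * (y * y) * (y * y * (y * y))) by ring.
  (* Repeated squaring, with decimal lower bounds along the way. *)
  set a := 341 / 320; have a1 : a = 341 / 320 by [].
  have a2 : 1135 / 1000 <= a * a by rewrite a1; lra.
  have a3 : 1288 / 1000 <= a * a * (a * a) by nra.
  set c := a * a * (a * a) in a3 *.
  have a4 : 1658 / 1000 <= c * c by nra.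
  nra.
rewrite expRN invf_ple ?posrE ?expR_gt0//.
rewrite (_ : 1 + 1 / 20 = 21 / 20 :> R); lra.
Qed.

Lemma ln_le_line3 : ln x <= 1 / 8 * x + 2.
Proof.
apply: ln_le_line => //; rewrite expRN invf_ple ?posrE ?expR_gt0//.
have h : 2 <= expR 1 :> R by apply: le_trans (expR_ge1Dx _); lra.
rewrite (_ : 1 + 2 = 3%:R * 1 :> R); last lra.
rewrite expRM_natl !exprS expr0; nra.
Qed.

End ln_bounds.

(** * Small exponents: constants, exponents and summation *)

Section small_alpha.
Context {R : realType} {d : measure_display} {T : measurableType d}.
Variables (P : probability T R) (Z : R -> {RV P >-> R}) (r : R -> R).
Variables (alpha C h H eta gam : R) (m : nat).
Hypothesis Zr : std_stationary_gaussian Z r.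
Hypotheses (alpha0 : 0 < alpha) (C0 : 0 < C) (h0 : 0 < h).
Hypothesis r_o : (fun t : R => r t - (1 - C * `|t| `^ alpha)) =o_ (0 : R)
  (fun t : R => `|t| `^ alpha).
Hypothesis r_loc : forall t, 0 < t <= h -> 4 / 5 * (C * t `^ alpha) <= 1 - r t.
Hypothesis HH : pickands_theorem_for alpha H.
Notation pr A := (fine (P A)).

(** Here [1 - lam = - 0.2848] lies just below [- 71 / 250], the lower bound for [alpha * EY]; this
    is what recovers the base [e * alpha / 2]. *)
Let lam : R := 803 / 625.
(** Makes [x k >= 64] once [k >= expR (Lam / alpha)]. *)
Let Lam : R := ln 64 + lam.
Let c0 : R := expR (- 3) / 12.

Hypotheses (eta0 : 0 < eta) (eta_small : eta * (1000 * 1000 * 10) <= 1).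
Hypothesis gam_small : gam * (200 * 1000) <= 1.
Hypotheses (m0 : (0 < m)%N) (m_eta : m%:R^-1 <= eta)
  (m_alpha : (2 * m%:R) `^ alpha <= 1 + eta)
  (single_small : 4 * expR (- gam / alpha) <= c0 / 2)
  (sum_small : expR (- (1 / 100) / alpha) * (4 + 2 * Lam / alpha) <= c0 / 4).

Let S : R := 11 / 5 / alpha.
Let X : R := (S / C) `^ alpha^-1.
Let a : R := (2 * expR (- lam) / alpha / C) `^ alpha^-1.
(** Take [An = B = S]. To first order, conditioning [Y] on the value [u + tau / u] centres [Z] at
    [u + (tau - 3 S / 4) / u] and the average at [u - (9 S / 4 - tau) / u]. With [tau = 0.754 S] and
    [M = 1.492 S], both conditions of [truncated] hold at these centres with margin
    [0.004 S / u]. *)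
Let M : R := 373 / 250 * S.
Let tau : R := 377 / 500 * S.
(** [ka1] and [ka2] are at or near the minimisers of the exponents in [single_E1] and
    [single_E2]. *)
Let ka1 : R := 2 / 125.
Let ka2 : R := 1 / 500.

Let S0 : 0 < S. Proof. by rewrite !divr_gt0. Qed.
Let c00 : 0 < c0. Proof. by rewrite divr_gt0 ?expR_gt0. Qed.
Let X0 : 0 < X. Proof. by apply: powR_gt0; rewrite divr_gt0. Qed.

Let SC : C * X `^ alpha = S.
Proof.
rewrite /X -powRrM mulVf ?gt_eqF// powRr1; last by rewrite ltW// divr_gt0.
by field; rewrite gt_eqF.
Qed.

Let base0 : 0 < 2 * expR (- lam) / alpha / C.
Proof. by rewrite !divr_gt0// mulr_gt0 ?expR_gt0. Qed.

Let a0 : 0 < a. Proof. by apply: powR_gt0. Qed.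

(* Half the exponent [C * (a * k) `^ alpha], in units of [1 / alpha]. *)
Let x (k : nat) : R := expR (- lam) * k%:R `^ alpha.

Let aCk (k : nat) : C * (a * k%:R) `^ alpha = 2 * x k / alpha.
Proof.
rewrite powRM ?(ltW a0)// /a -powRrM mulVf ?gt_eqF// powRr1 ?(ltW base0)// /x.
by field; rewrite !gt_eqF.
Qed.

Let aC : a * C `^ alpha^-1 = (2 * expR (- lam) / alpha) `^ alpha^-1.
Proof.
have b0 : 0 < 2 * expR (- lam) / alpha by rewrite divr_gt0// mulr_gt0 ?expR_gt0.
rewrite /a -powRM ?(ltW C0) ?(ltW base0)//.
by rewrite divfK// gt_eqF.
Qed.

Let x_gt0 k : (0 < k)%N -> 0 < x k.
Proof. by move=> k0; rewrite mulr_gt0 ?expR_gt0// powR_gt0// ltr0n. Qed.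

Let ln_x k : (0 < k)%N -> ln (x k) = alpha * ln k%:R - lam.
Proof.
move=> k0; rewrite lnM ?posrE ?expR_gt0 ?powR_gt0 ?ltr0n// expRK ln_powR.
by rewrite addrC.
Qed.

Let An := avg_near alpha C X m.
Let B := avg_self alpha C X m.
Let etaS : R := eta * S.
Let etaS0 : 0 < etaS. Proof. exact: mulr_gt0. Qed.

Let etaSE : etaS * (1000 * 1000 * 10) <= S.
Proof. by have := ler_wpM2r (ltW S0) eta_small; rewrite mul1r mulrAC. Qed.

Let gamSE : gam * S * (200 * 1000) <= S.
Proof. by have := ler_wpM2r (ltW S0) gam_small; rewrite mul1r mulrAC. Qed.

Let An_ge : S <= An.
Proof. by rewrite -SC; exact: avg_near_ge. Qed.

Let An_le : An <= S + etaS.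
Proof.
apply: (le_trans (avg_near_le alpha0 C0 X0 m0)); rewrite SC.
by apply: (le_trans (ler_wpM2r (ltW S0) m_alpha)); rewrite mulrDl mul1r.
Qed.

Let B_le : B <= S + etaS.
Proof.
apply: (le_trans (avg_self_le alpha0 C0 X0 m0)); rewrite SC.
by apply: (le_trans (ler_wpM2r (ltW S0) m_alpha)); rewrite mulrDl mul1r.
Qed.

Let B_ge : S - etaS <= B.
Proof.
apply: le_trans (avg_self_ge alpha0 C0 X0 m0); rewrite SC mulrBl mul1r lerD2l lerN2.
by apply: ler_wpM2r => //; exact: ltW.
Qed.

Let EY : R := 3 / 4 * An - B / 8 - tau.

(** At [An = B = S] the exponent is [- 0.129 S = - 0.2838 / alpha]; rounding to [0.284] leaves room
    for the errors of size [eta * S]. *)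
Let EY_ge : - (71 / 250) / alpha <= EY.
Proof.
have -> : - (71 / 250) / alpha =
    - (71 / 250) * (5 / 11) * S by rewrite /S; field; rewrite gt_eqF.
move: An_ge B_le etaSE etaS0 S0; rewrite /EY /tau; lra.
Qed.

Let single_EY : avg_tail alpha C X m (1 + 1 / 2) 0 (- (1 / 2)) 0 tau = expR EY.
Proof.
rewrite /avg_tail qform_avg// -/An -/B; congr expR; rewrite /EY; by field.
Qed.

Let single_E1 : avg_tail alpha C X m ((1 + ka1) * (1 + 1 / 2) - ka1) 0
    (- ((1 + ka1) * (1 / 2))) 0 ((1 + ka1) * tau) <=
  expR EY * expR (- gam / alpha).
Proof.
rewrite /avg_tail qform_avg// -/An -/B -expRD ler_expR.
have -> : - gam / alpha = - (5 / 11) * (gam * S).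
  by rewrite /S; field; rewrite gt_eqF.
move: An_ge An_le B_ge B_le etaSE etaS0 gamSE S0; rewrite /EY /tau /ka1; lra.
Qed.

(** The tighter of the two failure terms: at [An = B = S] its exponent is below [EY] by
    [3.5 * 10^-6 * S], against [gam / alpha <= 2.3 * 10^-6 * S]. This explains the sizes of [gam]
    and [eta]. *)
Let single_E2 : avg_tail alpha C X m ((1 - ka2) * (1 + 1 / 2)) 0
    (ka2 - (1 - ka2) * (1 / 2)) 0 ((1 - ka2) * tau - ka2 * M) <=
  expR EY * expR (- gam / alpha).
Proof.
rewrite /avg_tail qform_avg// -/An -/B -expRD ler_expR.
have -> : - gam / alpha = - (5 / 11) * (gam * S).
  by rewrite /S; field; rewrite gt_eqF.
move: An_ge An_le B_ge B_le etaSE etaS0 gamSE S0; rewrite /EY /tau /M /ka2; lra.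
Qed.

Let G : R := expR (EY - 1 / 100 / alpha).

(** Since [ln k = (ln (x k) + lam) / alpha], the factor [1 / k] is paid for by a linear bound on
    [ln (x k)]. *)
Let pair_bound k : (0 < k)%N ->
  avg_tail alpha C X m (1 + 1 - 3 / 4) (3 / 4) (- 1) (a * k%:R) (1 * M) <=
  G / k%:R.
Proof.
move=> k0; have kR0 : 0 < k%:R :> R by rewrite ltr0n.
have ak0 : 0 <= a * k%:R by rewrite mulr_ge0 ?(ltW a0).
have -> : G / k%:R = expR (EY - 1 / 100 / alpha - ln k%:R).
  by rewrite expRD expRN lnK.
rewrite /avg_tail qform_avg// -/An -/B ler_expR.
set F := avg_far _ _ _ _ _.
have aln : ln k%:R = (ln (x k) + lam) / alpha.
  by rewrite ln_x// subrK mulrAC divff ?mul1r// gt_eqF.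
have l1 := ln_le_line1 (x_gt0 k0); have l2 := ln_le_line2 (x_gt0 k0).
set s := C * (a * k%:R) `^ alpha.
set v := alpha^-1.
have v0 : 0 < v by rewrite invr_gt0.
have sE : s = 2 * (x k * v) by rewrite /s aCk mulrA.
have SE : S = 11 / 5 * v by [].
set y := x k * v in sE.
have y0 : 0 < y by rewrite mulr_gt0// x_gt0.
set l := ln (x k) in l1 l2 aln.
have L1 : l * v <= 15 / 8 * y - 8 / 5 * v.
  by have := ler_wpM2r (ltW v0) l1; rewrite /y; lra.
have L2 : l * v <= 4 / 11 * y + 1 / 20 * v.
  by have := ler_wpM2r (ltW v0) l2; rewrite /y; lra.
have lE : ln k%:R = l * v + lam * v by rewrite aln -/v mulrDl.
rewrite lE /lam.
have EYv : - (71 / 250) * v <= EY by exact: EY_ge.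
(* Up to distance [X], [F] is at most about [S] and [s] keeps its coefficient [- 15 / 16], matched
   by [L1]. Beyond, [F] may be about [s], the coefficient shrinks to [- 3 / 16], and [L2] takes
   over. *)
have [kX|Xk] := leP (a * k%:R) X.
  have FS : F <= S + etaS.
    apply: (le_trans (avg_far_le alpha0 C0 X0 m0 ak0 kX (lexx _))); rewrite SC.
    by apply: (le_trans (ler_wpM2r (ltW S0) m_alpha)); rewrite mulrDl mul1r.
  by move: An_ge An_le B_ge B_le etaSE etaS0 S0; rewrite /M; lra.
have Fs : F <= s + eta * s.
  have s0 : 0 <= s by rewrite sE mulr_ge0// ltW.
  apply: (le_trans (avg_far_le alpha0 C0 X0 m0 ak0 (lexx _) (ltW Xk))).
  by apply: (le_trans (ler_wpM2r s0 m_alpha)); rewrite mulrDl mul1r.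
have etas : eta * s * (1000 * 1000 * 10) <= s.
  have s0 : 0 <= s by rewrite sE mulr_ge0// ltW.
  by have := ler_wpM2r s0 eta_small; rewrite mul1r mulrAC.
by move: An_ge An_le B_ge B_le etaSE etaS0 S0; rewrite /M; lra.
Qed.

(** Independent of [u], so the asymptotic pair estimate is needed at finitely many lags only; longer
    lags use the non-asymptotic one. *)
Let cut : nat := Num.truncn (expR (Lam / alpha)).

Let Lam0 : 0 < Lam.
Proof. by apply: addr_gt0; [apply: ln_gt0; lra|rewrite /lam; lra]. Qed.

Let cut1 : (0 < cut)%N.
Proof. by rewrite truncn_gt0 -expR0 ler_expR divr_ge0// ltW. Qed.

Let G0 : 0 < G. Proof. exact: expR_gt0. Qed.

(** With [x k >= 64], the linear term [2 * x k / 5] dominates [2 * ln (x k)] and all the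
    constants. *)
Let far_bound k : (cut < k)%N ->
  expR (- (C * (a * k%:R) `^ alpha / 5)) <= G * k%:R ^- 2.
Proof.
move=> ck; have k0 : (0 < k)%N by exact: leq_ltn_trans ck.
have kR0 : 0 < k%:R :> R by rewrite ltr0n.
have kL : Lam / alpha <= ln k%:R.
  have : expR (Lam / alpha) < k%:R.
    by apply: lt_le_trans (truncnS_gt _) _; rewrite ler_nat.
  by move=> /ltW ek; rewrite -[leLHS]expRK ler_ln ?posrE ?expR_gt0.
have x64 : 64 <= x k.
  rewrite -ler_ln ?posrE ?x_gt0// ln_x// lerBrDr mulrC -ler_pdivrMr//.
have -> : G * k%:R ^- 2 = expR (EY - 1 / 100 / alpha - 2%:R * ln k%:R).
  by rewrite expRD expRN expRM_natl lnK.
rewrite ler_expR aCk.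
have aln : ln k%:R = (ln (x k) + lam) / alpha.
  by rewrite ln_x// subrK mulrAC divff ?mul1r// gt_eqF.
have l3 := ln_le_line3 (x_gt0 k0).
set v := alpha^-1; have v0 : 0 < v by rewrite invr_gt0.
set l := ln (x k) in l3 aln.
have L3 : l * v <= 1 / 8 * (x k * v) + 2 * v.
  by have := ler_wpM2r (ltW v0) l3; lra.
have lE : ln k%:R = l * v + lam * v by rewrite aln -/v mulrDl.
have yv : 64 * v <= x k * v by rewrite ler_pM2r.
have EYv : - (71 / 250) * v <= EY by exact: EY_ge.
rewrite lE /lam; lra.
Qed.

Let b (k : nat) : R := if (k <= cut)%N then
    2 * avg_tail alpha C X m (1 + 1 - 3 / 4) (3 / 4) (- 1) (a * k%:R) (1 * M)
  else expR (- (C * (a * k%:R) `^ alpha / 5)).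

(** Near lags give a harmonic sum, at most [1 + Lam / alpha] because [cut] is exponential in
    [1 / alpha]; the factor [expR (- 1 / (100 alpha))] inside [G] outweighs it by [sum_small]. *)
Let sum_b n : \sum_(i < n) b i.+1 <= c0 / 2 * expR EY / 2.
Proof.
apply: (@le_trans _ _ (\sum_(i < n) ((if (i < cut)%N then 2 * G / i.+1%:R else 0) +
    G * i.+1%:R ^- 2))).
  apply: ler_sum => i _; rewrite /b.
  have G2 : 0 <= G * i.+1%:R ^- 2 by rewrite mulr_ge0 ?(ltW G0)// invr_ge0 exprn_ge0.
  case: ifPn => ic; last by rewrite add0r far_bound// ltnNge.
  by rewrite ler_wpDr// -[2 * G / _]mulrA ler_pM2l//; exact: pair_bound.
rewrite big_split /= -mulr_sumr.
have s1 : \sum_(i < n) (if (i < cut)%N then 2 * G / i.+1%:R else 0) <=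
    2 * G * (1 + Lam / alpha).
  apply: le_trans (sum_truncate_le (f := fun i => 2 * G / i.+1%:R) cut n _) _.
    by move=> i; rewrite divr_ge0// mulr_ge0// ltW.
  rewrite -mulr_sumr ler_pM2l ?mulr_gt0//.
  rewrite -(prednK cut1); apply: le_trans (harmonic_le _) _.
  rewrite prednK// lerD2l -[leRHS]expRK ler_ln ?posrE ?expR_gt0 ?ltr0n//.
  by rewrite truncn_le expR_ge0.
have s2 : G * \sum_(i < n) i.+1%:R ^- 2 <= G * 2.
  by rewrite ler_pM2l//; exact: sum_inv_sqr_le.
apply: le_trans (lerD s1 s2) _.
have GE : G = expR EY * expR (- (1 / 100) / alpha) by rewrite -expRD mulNr.
have := ler_wpM2l (expR_ge0 EY) sum_small; rewrite mulrA -GE.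
set q := Lam / alpha.
rewrite (_ : 2 * Lam / alpha = 2 * q); last by rewrite /q mulrA.
lra.
Qed.

Lemma pickands_small_alpha_bound :
  c0 / 2 * (expR 1 * alpha / 2) `^ alpha^-1 <= H.
Proof.
have p0 : 0 < c0 / 2 * expR EY by rewrite mulr_gt0 ?expR_gt0// divr_gt0.
have key : c0 / 2 * expR EY <= H * (a * C `^ alpha^-1).
  apply: (pickands_lower_bound Zr alpha0 C0 h0 r_o r_loc HH a0 p0 (b := b)
    (A := fun u j => truncated Z alpha X m M u (j%:R * (a * mesh alpha u)))).
  - by move=> u j; exact: measurable_truncated.
  - by move=> u j w [].
  - have ka10 : 0 <= ka1 by rewrite divr_ge0.
    have ka20 : 0 <= ka2 < 1 by rewrite /ka2; apply/andP; split; lra.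
    apply: filterS (truncated_single_ge X Zr alpha0 m0 r_o (1 / 2) tau M ka10 ka20) => u tu j.
    apply: le_trans (tu (j%:R * (a * mesh alpha u))).
    rewrite single_EY -/c0.
    (* The two failure terms cost at most half of the main term. *)
    have := ler_wpM2l (expR_ge0 EY) single_small.
    have := single_E1; have := single_E2; lra.
  - have npos : \forall u \near +oo, 0 < (u : R) by exact: nbhs_pinfty_gt.
    have la0 : 0 < 3 / 4 :> R by [].
    have la1 : 3 / 4 <= 1 + 1 :> R by lra.
    have near_pairs : \forall u \near +oo, forall k : 'I_cut.+1, forall t,
        u * expR (u ^+ 2 / 2) * pr (truncated Z alpha X m M u t `&`
          truncated Z alpha X m M u (t + a * k%:R * mesh alpha u)) <=
        2 * avg_tail alpha C X m (1 + 1 - 3 / 4) (3 / 4) (- 1) (a * k%:R) (1 * M).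
      apply: filter_forall => k.
      exact: (truncated_pair_le X Zr alpha0 m0 r_o M (a * k%:R) la0 ler01 la1).
    apply: filterS (filterI npos near_pairs) => u [u0 pairs] i j ij jh.
    rewrite /b; case: ifPn => [kc|_].
      have kc' : (j - i < cut.+1)%N by [].
      have := pairs (Ordinal kc') (i%:R * (a * mesh alpha u)) => /=.
      rewrite (_ : i%:R * (a * mesh alpha u) + _ = j%:R * (a * mesh alpha u))//.
      by rewrite natrB ?(ltnW ij)//; ring.
    apply: le_trans (mesh_pair_tail_le Zr alpha0 C0 r_loc u0 a0 ij jh).
    have K0 : 0 < u * expR (u ^+ 2 / 2) by rewrite mulr_gt0 ?expR_gt0.
    rewrite ler_pM2l//; apply: pr_le.
    + by apply: measurableI; exact: measurable_truncated.
    + by apply: measurableI; apply: measurable_gt; exact: measurable_funPT.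
    + by move=> w [[? _] [? _]].
  - exact: sum_b.
have b0 : 0 < 2 * expR (- lam) / alpha by rewrite divr_gt0// mulr_gt0 ?expR_gt0.
have bp : 0 < (2 * expR (- lam) / alpha) `^ alpha^-1 by rewrite powR_gt0.
rewrite -(ler_pM2r bp) -aC; apply: le_trans key.
rewrite -[leLHS]mulrA; apply: ler_wpM2l; first by rewrite divr_ge0 ?(ltW c00).
rewrite aC -powRM ?(ltW b0)//; last by rewrite ltW// divr_gt0// mulr_gt0 ?expR_gt0.
(* The spacing cancels [alpha / 2], leaving [expR ((1 - lam) / alpha)] to compare with [expR EY]. *)
have -> : expR 1 * alpha / 2 * (2 * expR (- lam) / alpha) = expR (1 - lam).
  by rewrite expRD; field; rewrite gt_eqF.
rewrite -expRM ler_expR; apply: le_trans EY_ge.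
by rewrite ler_pM2r ?invr_gt0// /lam; lra.
Qed.

End small_alpha.

(** * Thresholds for small exponents *)

Lemma pickands_small_alpha (R : realType) :
  exists2 alpha1 : R, 0 < alpha1 & forall alpha H : R, 0 < alpha <= alpha1 ->
    is_pickands_constant alpha H ->
    expR (- 3) / 12 / 2 * (expR 1 * alpha / 2) `^ alpha^-1 <= H.
Proof.
have [eta eta0 eta1] : exists2 eta : R, 0 < eta & eta * (1000 * 1000 * 10) <= 1.
  have y0 : 0 < 10^-1 :> R by rewrite invr_gt0 ltr0n.
  exists (10^-1 ^+ 7); first exact: exprn_gt0.
  have y1 : 10^-1 * 10 = 1 :> R by rewrite mulVf// pnatr_eq0.
  set y := 10^-1 in y1 *.
  have -> : y ^+ 7 * (1000 * 1000 * 10) = (y * 10) ^+ 7 by ring.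
  by rewrite y1 expr1n.
have [gam gam0 gam1] : exists2 gam : R, 0 < gam & gam * (200 * 1000) <= 1.
  by exists eta; [exact: eta0|lra].
have [m m0 mE] : exists2 m, (0 < m)%N & m%:R^-1 <= eta.
  have := truncnS_gt eta^-1; move: (Num.truncn _) => n en; exists n.+1 => //.
  by rewrite -[leRHS]invrK lef_pV2 ?posrE ?invr_gt0 ?ltr0n// ltW.
have mR1 : 1 <= m%:R :> R by rewrite ler1n.
have m1 : 1 < 2 * m%:R :> R by lra.
have lm0 : 0 < ln (2 * m%:R) :> R by rewrite ln_gt0.
pose Lam : R := ln 64 + 803 / 625.
have Lam0 : 0 < Lam by apply: addr_gt0; [apply: ln_gt0; lra|lra].
pose c0 : R := expR (- 3) / 12.
have c00 : 0 < c0 by rewrite divr_gt0 ?expR_gt0.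
(* [al1] gives [(2 m)^alpha <= 1 + eta]; [al2] and [al3] give [single_small] and [sum_small] through
   [expR (- y) <= 1 / y] and [expR (- y) <= (2 / y)^2]. The further cap at 1 bounds [4 * alpha] in
   the last estimate. *)
pose al1 := ln (1 + eta) / ln (2 * m%:R).
pose al2 := c0 / 8 * gam.
pose al3 := c0 / 4 / (200 * 200 * (4 + 2 * Lam)).
have q0 : 0 < 200 * 200 * (4 + 2 * Lam) by lra.
have pos1 : 0 < al1 by rewrite divr_gt0// ln_gt0// ltrDl.
have pos2 : 0 < al2 by rewrite mulr_gt0// divr_gt0.
have pos3 : 0 < al3 by rewrite divr_gt0// divr_gt0.
exists (Num.min (Num.min al1 1) (Num.min al2 al3)).
  by rewrite !lt_min pos1 pos2 pos3 ltr01.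
move=> alpha H /andP[a0]; rewrite !le_min => /andP[/andP[a1 a11] /andP[a2 a3]] HH.
apply: (pickands_constant_elim a0 HH) => d T P Z r C h C0 h0 Zr r_o loc.
apply: (pickands_small_alpha_bound Zr a0 C0 h0 r_o loc HH.1 eta0 eta1 gam1 m0 mE).
- have e1 : 0 < 1 + eta by rewrite addr_gt0.
  have m2 : 0 < 2 * m%:R :> R by exact: lt_trans m1.
  rewrite -[leRHS](@lnK R)// /powR (gt_eqF m2) ler_expR -ler_pdivlMr//.
- rewrite -/c0 mulNr.
  have g0 : 0 < gam / alpha by rewrite divr_gt0.
  have h1 : expR (- (gam / alpha)) <= alpha / gam.
    have := expRN_le_inv_pow 1 g0; rewrite expr1.
    by rewrite (_ : 1 / (gam / alpha) = alpha / gam)//; field; rewrite !gt_eqF.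
  have : alpha / gam <= c0 / 8 by rewrite ler_pdivrMr.
  lra.
- rewrite -/Lam -/c0 mulNr.
  have g0 : 0 < 1 / 100 / alpha by rewrite divr_gt0// divr_gt0.
  have h1 := expRN_le_inv_pow 2 g0.
  have h2 : 0 <= 4 + 2 * Lam / alpha.
    by apply: addr_ge0 => //; apply: divr_ge0; [lra|exact: ltW].
  apply: (le_trans (ler_wpM2r h2 h1)).
  have -> : (2 / (1 / 100 / alpha)) ^+ 2 * (4 + 2 * Lam / alpha) =
      200 * 200 * (4 * alpha + 2 * Lam) * alpha by field; rewrite gt_eqF.
  move: a3; rewrite ler_pdivlMr// => a3.
  apply: le_trans a3; rewrite [leRHS]mulrC; apply: ler_wpM2r; first exact: ltW.
  lra.
Qed.

(** * Combination of the two ranges of exponents *)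

Theorem corollary1 (R : realType) :
  exists c : R, 0 < c /\
    forall alpha H : R, 0 < alpha <= 2 -> is_pickands_constant alpha H ->
      c * Num.sqrt alpha * (expR 1 * alpha / 2) `^ alpha^-1 <= H.
Proof.
have [alpha1 a10 small] := pickands_small_alpha R.
have [c2 c20 large] := pickands_large_alpha a10.
set c1 : R := expR (- 3) / 12 / 2 in small.
have c10 : 0 < c1 by rewrite divr_gt0// divr_gt0 ?expR_gt0.
(* The halves absorb [sqrt alpha <= 2], and [expR (1 / alpha1)] bounds the power [Q] when
   [alpha1 <= alpha <= 2]. *)
pose c : R := Num.min (c1 / 2) (c2 / (2 * expR alpha1^-1)).
have e0 : 0 < 2 * expR alpha1^-1 by rewrite mulr_gt0 ?expR_gt0.
have c0 : 0 < c by rewrite lt_min !divr_gt0.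
exists c; split=> // alpha H /andP[alpha0 alpha2] HH.
set Q := _ `^ _; have Q0 : 0 <= Q by exact: powR_ge0.
have s2 : Num.sqrt alpha <= 2.
  rewrite -[leRHS]ger0_norm// -sqrtr_sqr ler_sqrt ?sqr_ge0//; lra.
have s0 := sqrtr_ge0 alpha.
have [aa|aa] := leP alpha alpha1.
  have a0a : 0 < alpha <= alpha1 by rewrite alpha0.
  apply: le_trans (small _ _ a0a HH); rewrite -/Q; apply: ler_wpM2r => //.
  have -> : c1 = c1 / 2 * 2 by field.
  by apply: ler_pM => //; [exact: ltW|rewrite ge_min lexx].
have aa2 : alpha1 <= alpha <= 2 by rewrite (ltW aa).
apply: le_trans (large _ _ aa2 HH).
have ea := expR_ge0 (1 : R).
have QE : Q <= expR alpha1^-1.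
  apply: (@le_trans _ _ (expR 1 `^ alpha^-1)).
    apply: ge0_ler_powR; rewrite ?nnegrE ?invr_ge0 ?(ltW alpha0)//.
      by rewrite divr_ge0// mulr_ge0// ltW.
    by rewrite -mulrA ler_piMr//; lra.
  by rewrite -expRM mul1r ler_expR lef_pV2 ?posrE// ltW.
apply: (@le_trans _ _ (c2 / (2 * expR alpha1^-1) * 2 * expR alpha1^-1)).
  apply: ler_pM => //; first by rewrite mulr_ge0// ltW.
  by apply: ler_pM => //; [exact: ltW|rewrite ge_min lexx orbT].
by rewrite -mulrA divfK// gt_eqF.
Qed.
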